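(* Let $\mu$ and $\nu$ be compactly supported probability measures on $[0,\infty)$, both different from $\delta_0$. Then $$S_\mu(s)\,S_\nu(s)=S_{\mu\boxtimes\nu}(s)\qquad\text{for every }-1\le s\le0,$$ where $\boxtimes$ denotes the free multiplicative convolution.
   Context: $S$-transform: for a compactly supported probability measure $\mu\neq\delta_0$ on $[0,\infty)$ put $\psi_\mu(t)=\int\frac{1}{1-tx}\,d\mu(x)-1$ and $S_\mu(z)=\frac{z+1}{z}\psi_\mu^{\langle-1\rangle}(z)$, where $\langle-1\rangle$ denotes inverse under composition (this is the $S$-transform of a nonnegative operator $a$ with distribution $\mu$ in a tracial probability space). The function $\psi_\mu:(-\infty,0]\to(\mu(\{0\})-1,0]$ is an increasing bijection, so $S_\mu$ is defined and positive on $(\mu(\{0\})-1,0)$. Boundary values: $S_\mu(0)=\lim_{z\to0^-}S_\mu(z)$; if $\mu(\{0\})=0$ then $S_\mu(-1)=\lim_{\epsilon\to0^+}S_\mu(-1+\epsilon)\in(0,\infty]$; if $\mu(\{0\})>0$ then $S_\mu=\infty$ on $[-1,\mu(\{0\})-1]$. Products are taken in $(0,\infty]$. Free multiplicative convolution: $\mu\boxtimes\nu$ is the distribution of $a^{1/2}ba^{1/2}$, where $a,b\ge0$ are free elements of a von Neumann algebra with normal faithful tracial state, with distributions $\mu$ and $\nu$ respectively. *)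

(* Defs.v *)
From HB Require Import structures.
From mathcomp Require Import all_boot all_order all_algebra.
From mathcomp Require Import complex sesquilinear.
From mathcomp Require Import all_classical all_reals all_analysis.

Set Implicit Arguments.
Unset Strict Implicit.
Unset Printing Implicit Defensive.

Import Order.TTheory GRing.Theory Num.Theory.
Import numFieldNormedType.Exports.

Local Open Scope classical_set_scope.
Local Open Scope ring_scope.
Local Open Scope complex_scope.

Section Operators.
Variables (R : realType) (H : completeNormedModType R[i]).
Variable dotp : {dot H for (@Num.conj R[i])}.

Definition bounded_op (T : H -> H) : Prop := linear T /\ continuous T.

Definition adjoint_op (T S : H -> H) : Prop :=
  forall x y, dotp (T x) y = dotp x (S y).

(* Loewner order; over the complex field [0 <= dotp (T x) x] for all x
   already forces T to be self-adjoint, since the order of R[i] only relates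
   numbers with equal imaginary parts. *)
Definition op_le (S T : H -> H) : Prop :=
  forall x, dotp (S x) x <= dotp (T x) x.

Definition op_ge0 (T : H -> H) : Prop := op_le \0 T.

Record unital_star_algebra (A : set (H -> H)) : Prop := {
  usa_bounded : forall T, A T -> bounded_op T ;
  usa_one : A idfun ;
  usa_lin : forall (c : R[i]) S T, A S -> A T -> A (c *: S + T) ;
  usa_comp : forall S T, A S -> A T -> A (S \o T) ;
  usa_adj : forall T, A T -> exists2 T', A T' & adjoint_op T T' }.

Definition commutant (A : set (H -> H)) : set (H -> H) :=
  [set T | bounded_op T /\ forall S, A S -> T \o S = S \o T].

Definition von_neumann_algebra (M : set (H -> H)) : Prop :=
  unital_star_algebra M /\ commutant (commutant M) = M.

Definition star_alg_gen (a : H -> H) : set (H -> H) :=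
  smallest unital_star_algebra [set a].

Record normal_faithful_tracial_state
    (M : set (H -> H)) (tau : (H -> H) -> R[i]) : Prop := {
  state_lin : forall (c : R[i]) S T, M S -> M T ->
    tau (c *: S + T) = c * tau S + tau T ;
  state_one : tau idfun = 1 ;
  state_ge0 : forall T, M T -> op_ge0 T -> 0 <= tau T ;
  state_faithful : forall T, M T -> op_ge0 T -> tau T = 0 -> T = \0 ;
  state_tracial : forall S T, M S -> M T -> tau (S \o T) = tau (T \o S) ;
  (* tau preserves suprema of bounded increasing nets of positive operators *)
  state_normal : forall (D : set (H -> H)) T,
    D !=set0 -> D `<=` M -> (forall S, D S -> op_ge0 S) ->
    (forall S1 S2, D S1 -> D S2 -> exists S, [/\ D S, op_le S1 S & op_le S2 S]) ->
    M T -> (forall S, D S -> op_le S T) ->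
    (forall T', M T' -> (forall S, D S -> op_le S T') -> op_le T T') ->
    supremums (tau @` D) (tau T) }.

(* Freeness of a family of algebras: alternating products of centered
   elements are centered. *)
Definition free_algebras (tau : (H -> H) -> R[i]) (I : Type)
    (A : I -> set (H -> H)) : Prop :=
  forall (n : nat) (k : nat -> I) (T : nat -> H -> H),
    (forall i, (i < n)%N -> k i <> k i.+1) ->
    (forall i, (i <= n)%N -> A (k i) (T i) /\ tau (T i) = 0) ->
    tau (\big[(fun f g : H -> H => f \o g)/idfun]_(i < n.+1) T i) = 0.

Definition free_elements (tau : (H -> H) -> R[i]) (a b : H -> H) : Prop :=
  free_algebras tau (fun i : bool => star_alg_gen (if i then a else b)).

End Operators.

(* A von Neumann algebra with a normal faithful tracial state, acting on a
   complex Hilbert space; the state is only meaningful on [wp_alg]. *)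
Record tracial_space (R : realType) := {
  wp_space : completeNormedModType R[i] ;
  wp_dotp : {dot wp_space for (@Num.conj R[i])} ;
  wp_norm : forall x : wp_space, `|x| ^+ 2 = wp_dotp x x ;
  wp_alg : set (wp_space -> wp_space) ;
  wp_vN : von_neumann_algebra wp_dotp wp_alg ;
  wp_tr : (wp_space -> wp_space) -> R[i] ;
  wp_state : normal_faithful_tracial_state wp_dotp wp_alg wp_tr }.

Section Measures.
Variable R : realType.
Implicit Types mu nu rho : probability (measurableTypeR R) R.

Definition compactly_supported mu : Prop :=
  exists2 K : set R, compact K & mu (~` K) = 0%E.

Definition on_halfline mu : Prop := mu [set x : R | x < 0] = 0%E.

Definition is_dirac0 mu : Prop :=
  forall A, measurable A -> mu A = \d_(0 : R) A.

(* Distribution of a self-adjoint element: the compactly supported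
   probability measure with the same moments. *)
Definition has_distribution (W : tracial_space R)
    (a : wp_space W -> wp_space W) mu : Prop :=
  compactly_supported mu /\
  forall n, wp_tr (iter n a) = (\int[mu]_x (x ^+ n))%:C.

(* rho is the free multiplicative convolution of mu and nu; [c] is the
   positive square root of [a]. *)
Definition is_free_mul_conv mu nu rho : Prop :=
  exists (W : tracial_space R) (a b c : wp_space W -> wp_space W),
    [/\ [/\ wp_alg a, wp_alg b & wp_alg c],
        [/\ op_ge0 (wp_dotp W) a, op_ge0 (wp_dotp W) b,
            op_ge0 (wp_dotp W) c & c \o c = a],
        free_elements (wp_dotp W) (@wp_tr R W) a b,
        has_distribution a mu /\ has_distribution b nu &
        has_distribution (c \o b \o c) rho].

Definition psi mu (t : R) : R := (\int[mu]_x ((1 - t * x)^-1)) - 1.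

Definition psi_inv mu : R -> R := 'pinv_(fun=> 0) `]-oo, 0] (psi mu).

Definition S_interior mu (z : R) : R := (z + 1) / z * psi_inv mu z.

(* S-transform on [-1, 0] with its boundary values; the values outside this
   interval are irrelevant. *)
Definition S_transform mu (s : R) : \bar R :=
  if s == 0 then lim ((S_interior mu z)%:E @[z --> 0^'-])
  else if (s == -1) && (mu [set 0] == 0%E) then
    lim ((S_interior mu (-1 + e))%:E @[e --> 0^'+])
  else if (mu [set 0%R] - 1 < s%:E)%E then (S_interior mu s)%:E
  else +oo%E.

End Measures.

(* Main.v *)
(** For -1 < z < 0 let psi_mu(u) = psi_nu(v) = z and put A = (1 - u a)^-1,
    B = (1 - v b)^-1. Both have trace 1 + z, so p = A - (1 + z) and
    q = B - (1 + z) are free and centered, and with w = (1 + z) / z * u * v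
    and X = p q / (z (1 + z)) one computes
    A (1 - w a b) B = (1 + z) (1 - X).
    By freeness tau (B X^j A) = 0 for j >= 1, while
    tau (X^n (X^n)^* ) = (tau (p^2) tau (q^2) / (z (1 + z))^2)^n. Since A and B
    lie strictly between 0 and 1, tau (p^2) and tau (q^2) are smaller than
    (1 + z) - (1 + z)^2 = - z (1 + z), so the remainder of the Neumann series of
    (1 - X)^-1 tends to 0 in L^2 for every such z, not only for z close to 0,
    and no analytic continuation is needed. The outcome is
    tau ((1 - w a b)^-1) = 1 + z, that is, psi_rho(w) = z, which is
    S_mu(z) S_nu(z) = S_rho(z). Monotonicity of psi then forces
    rho{0} = max(mu{0}, nu{0}), and the values at 0 and -1 follow by passing to
    the limit. *)

(* The operator norm of [X] may exceed 1, so the Neumann series of (1 - X)^-1 need not converge in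
   norm. An inverse is therefore obtained beforehand: with c = a^(1/2) the operator c b c is
   positive and w < 0, so 1 - w c b c is invertible; this gives a right inverse of 1 - w a b and,
   through the factorization, of 1 - X. The expansion is then a finite identity with exact remainder
   [X ^+ n * F], and only a trace of that remainder has to vanish, which Cauchy-Schwarz for [tau]
   derives from the L^2 estimate. Strictness of the bound on tau (p^2) comes from faithfulness. Two
   definitions shape the rest. A distribution is known through its moments only: resolvents enter
   through explicit polynomials that converge to them both in norm and uniformly on the support, and
   that [rho] lives on the half-line must be extracted from moments. Freeness concerns the generated
   star-algebras without closure, so it is first carried over to norm limits. *)
Require Import Defs.
From HB Require Import structures.
From mathcomp Require Import all_boot all_order all_algebra.
From mathcomp Require Import complex sesquilinear.
From mathcomp Require Import all_classical all_reals all_analysis.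
From mathcomp Require Import measurable_realfun.
From mathcomp Require Import ring lra.
Import Order.TTheory GRing.Theory Num.Theory.
Import numFieldNormedType.Exports.
Set Implicit Arguments.
Unset Strict Implicit.
Unset Printing Implicit Defensive.
Local Open Scope classical_set_scope.
Local Open Scope ring_scope.

(** * Integration against a compactly supported probability *)

Section Supported.
Variables (R : realType).

Lemma measurable_inv_real : measurable_fun [set: R] (fun x : R => x^-1).
Proof.
have -> : [set: R] = [set 0] `|` ~` [set 0] by rewrite setUv.
apply/measurable_funU => //; first exact: measurableC.
split; first exact: measurable_fun_set1.
apply: open_continuous_measurable_fun; first by apply: closed_openC; exact/accessible_closed_set1/hausdorff_accessible/Rhausdorff.
move=> x; rewrite inE /= => /eqP x0; exact: inv_continuous.
Qed.

Variable mu : probability (measurableTypeR R) R.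

Definition supp (l h : R) := mu (~` `[l, h]%classic) = 0%E.

Lemma compact_supp (K : R) : compactly_supported mu ->
  exists2 L, K <= L & supp (- L) L.
Proof.
move=> [A cA A0]; have [M [Mr AM]] := compact_bounded cA.
pose L := Num.max K (`|M| + 1); exists L; first by rewrite le_max lexx.
apply: (subset_measure0 _ _ _ A0) => //.
- by apply: measurableC; exact: measurable_itv.
- by apply: measurableC; apply: closed_measurable; apply: compact_closed cA; exact: Rhausdorff.
apply: subsetC => x Ax; rewrite /= in_itv /= -ler_norml.
apply: (@le_trans _ _ (`|M| + 1)); last by rewrite le_max lexx orbT.
have Mlt : M < `|M| + 1.
  by apply: le_lt_trans (ler_norm M) _; rewrite ltrDl.
exact: (AM _ Mlt x Ax).
Qed.

Lemma halfline_supp l h : supp l h -> on_halfline mu -> supp 0 h.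
Proof.
rewrite /supp /on_halfline => s p.
have : (mu (~` `[l, h]%classic `|` [set x | (x < 0)%R]) <= 0 + 0)%E.
  rewrite -{1}s -p; apply: measureU2.
    by apply: measurableC; exact: measurable_itv.
  have -> : [set x : R | x < 0] = `]-oo, 0[%classic by apply/seteqP; split=> x; rewrite /= in_itv.
  exact: measurable_itv.
rewrite adde0 => le0; apply/eqP; rewrite eq_le measure_ge0 andbT.
apply: le_trans le0; apply: le_measure.
- by rewrite inE; apply: measurableC; exact: measurable_itv.
- rewrite inE; apply: measurableU.
    by apply: measurableC; exact: measurable_itv.
  have -> : [set x : R | x < 0] = `]-oo, 0[%classic by apply/seteqP; split=> x; rewrite /= in_itv.
  exact: measurable_itv.
move=> x /=; rewrite !in_itv /= => /negP; rewrite negb_and => /orP[|xh].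
  by rewrite -ltNge; right.
by left; apply/negP; rewrite negb_and xh orbT.
Qed.

Section Expectation.
Variables (l h : R).
Hypothesis slh : supp l h.

(** The integrals run over the whole line, where powers and resolvents are unbounded; a bound on the
    interval that carries [mu] is enough for integrability. *)
Definition tame (f : R -> R) := measurable_fun [set: measurableTypeR R] f /\
  exists K, forall x, l <= x <= h -> `|f x| <= K.

Let mD : measurable (`[l, h]%classic : set (measurableTypeR R)).
Proof. exact: measurable_itv. Qed.
Let mDc : measurable (~` `[l, h]%classic : set (measurableTypeR R)).
Proof. exact: measurableC. Qed.
Let setTDc : [set: R] `\` ~` `[l, h]%classic = `[l, h]%classic.
Proof. by rewrite setTD setCK. Qed.

Let tame_itv f : tame f -> mu.-integrable `[l, h] (EFin \o f).
Proof.
move=> [mf [K fK]]; apply: measurable_bounded_integrable => //.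
- by rewrite (le_lt_trans (probability_le1 mu mD))// ltry.
- exact: measurable_funTS.
exists K; split; first exact: num_real.
by move=> y Ky x /=; rewrite in_itv /= => xlh; exact: le_trans (fK _ xlh) (ltW Ky).
Qed.

Lemma tame_integrable f : tame f -> mu.-integrable setT (EFin \o f).
Proof.
move=> tf; apply/(negligible_integrable mDc measurableT _ slh).
  by apply/measurable_EFinP; exact: tf.1.
by rewrite setTDc; exact: tame_itv.
Qed.

Let Rint_itv f : tame f -> \int[mu]_x f x = \int[mu]_(x in `[l, h]) f x.
Proof.
move=> tf; rewrite /Rintegral (negligible_integral mDc measurableT (tame_integrable tf) slh).
by rewrite setTDc.
Qed.

Lemma int_le f g : tame f -> tame g -> (forall x, l <= x <= h -> f x <= g x) ->
  \int[mu]_x f x <= \int[mu]_x g x.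
Proof.
move=> tf tg fg; rewrite !Rint_itv//; apply: le_Rintegral => //; exact: tame_itv.
Qed.

Lemma int_cst k : \int[mu]_x k = k.
Proof. by rewrite Rintegral_cst// [X in fine X](_ : _ = 1%E) ?mulr1//; exact: (probability_setT mu). Qed.

Lemma intD f g : tame f -> tame g ->
  \int[mu]_x (f x + g x) = \int[mu]_x f x + \int[mu]_x g x.
Proof. by move=> tf tg; rewrite RintegralD//; exact: tame_integrable. Qed.

Lemma intZ k f : tame f -> \int[mu]_x (k * f x) = k * \int[mu]_x f x.
Proof. by move=> tf; rewrite RintegralZl//; exact: tame_integrable. Qed.

Lemma tame_cst k : tame (fun=> k).
Proof. by split=> //; exists `|k|. Qed.

Lemma tameD f g : tame f -> tame g -> tame (fun x => f x + g x).
Proof.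
move=> [mf [K fK]] [mg [L gL]]; split; first exact: measurable_funD.
exists (K + L) => x xlh; rewrite (le_trans (ler_normD _ _))// lerD//; [exact: fK|exact: gL].
Qed.

Lemma tameM f g : tame f -> tame g -> tame (fun x => f x * g x).
Proof.
move=> [mf [K fK]] [mg [L gL]]; split; first exact: measurable_funM.
exists (K * L) => x xlh; rewrite normrM ler_pM//; [exact: fK|exact: gL].
Qed.

Lemma tame_id : tame id.
Proof.
split; first exact: measurable_id.
exists (`|l| + `|h|) => x /andP[lx xh]; rewrite ler_norml.
have := ler_norm h; have := ler_norm (- l); rewrite normrN => ? ?.
have := normr_ge0 l; have := normr_ge0 h => ? ?.
by apply/andP; split; lra.
Qed.

Lemma tameX f n : tame f -> tame (fun x => f x ^+ n).
Proof.
move=> tf; elim: n => [|n ih]; first exact: tame_cst.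
by under eq_fun do rewrite exprS; exact: tameM.
Qed.

Lemma tame_sum (I : Type) (s : seq I) (F : I -> R -> R) : (forall i, tame (F i)) ->
  tame (fun x => \sum_(i <- s) F i x).
Proof.
move=> tF; elim: s => [|i s ih]; first by under eq_fun do rewrite big_nil; exact: tame_cst.
by under eq_fun do rewrite big_cons; exact: tameD.
Qed.

Lemma int_sum (I : Type) (s : seq I) (F : I -> R -> R) : (forall i, tame (F i)) ->
  \int[mu]_x (\sum_(i <- s) F i x) = \sum_(i <- s) \int[mu]_x F i x.
Proof.
move=> tF; elim: s => [|i s ih].
  by under eq_Rintegral do rewrite big_nil; rewrite int_cst big_nil.
under eq_Rintegral do rewrite big_cons.
by rewrite intD// ?ih ?big_cons//; exact: tame_sum.
Qed.

Lemma tame_poly (p : {poly R}) : tame (fun x => p.[x]).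
Proof.
under eq_fun do rewrite horner_coef; apply: tame_sum => i.
by apply: tameM; [exact: tame_cst|apply: tameX; exact: tame_id].
Qed.

Lemma int_poly (p : {poly R}) :
  \int[mu]_x p.[x] = \sum_(i < size p) p`_i * \int[mu]_x (x ^+ i).
Proof.
under eq_Rintegral do rewrite horner_coef; rewrite int_sum; last first.
  by move=> i; apply: tameM; [exact: tame_cst|apply: tameX; exact: tame_id].
by apply: eq_bigr => i _; rewrite intZ//; apply: tameX; exact: tame_id.
Qed.

Lemma tameV f e : 0 < e -> tame f -> (forall x, l <= x <= h -> e <= f x) ->
  tame (fun x => (f x)^-1).
Proof.
move=> e0 [mf _] fe; split.
  by apply: (measurableT_comp measurable_inv_real).
exists e^-1 => x /fe ef; have f0 : 0 < f x by exact: lt_le_trans ef.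
by rewrite gtr0_norm ?invr_gt0// lef_pV2.
Qed.
End Expectation.

Lemma tame_resolvent (L u : R) : u <= 0 -> tame 0 L (fun x => (1 - u * x)^-1).
Proof.
move=> u0; apply: (@tameV _ _ _ 1) => //.
  apply: tameD; first exact: tame_cst.
  by under eq_fun do rewrite -mulNr; apply: tameM; [exact: tame_cst|exact: tame_id].
by move=> x /andP[x0 _]; rewrite lerBrDl gerDr mulr_le0_ge0.
Qed.
End Supported.

(** * The function psi and its inverse *)

Section Psi.
Variables (R : realType) (mu : probability (measurableTypeR R) R) (L : R).
Hypotheses (L0 : 0 <= L) (sL : supp mu 0 L).
Implicit Types (t u x z : R).

Definition atom0 : R := fine (mu [set 0]).

Lemma atom0E : mu [set 0] = atom0%:E.
Proof. by rewrite /atom0 fineK// fin_num_measure. Qed.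

Lemma atom0_ge0 : 0 <= atom0.
Proof. by rewrite -lee_fin -atom0E. Qed.

Let f t x : R := (1 - t * x)^-1.
Let tf t : t <= 0 -> tame 0 L (f t). Proof. exact: tame_resolvent. Qed.

Let den t x : t <= 0 -> 0 <= x <= L -> 1 <= 1 - t * x <= 1 - t * L.
Proof.
move=> t0 /andP[x0 xL]; have : t * L <= t * x by rewrite ler_wnM2l.
by have := mulr_le0_ge0 t0 x0; lra.
Qed.

Let psiE t : 1 + psi mu t = \int[mu]_x f t x.
Proof. by rewrite /psi addrC subrK. Qed.

Lemma tame_indic (A : set (measurableTypeR R)) : measurable A ->
  tame 0 L (\1_A : R -> R).
Proof.
move=> mA; split; first exact: measurable_indic.
by exists 1 => x _; rewrite indicE; case: (_ \in _); rewrite ?normr1 ?normr0.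
Qed.

Lemma int_indic (A : set (measurableTypeR R)) : measurable A ->
  \int[mu]_x (\1_A x : R) = fine (mu A).
Proof. by move=> mA; rewrite /Rintegral integral_indic// setIT. Qed.

Let m1 : R := \int[mu]_x x.
Let ti : tame 0 L (fun x => x). Proof. exact: tame_id. Qed.

Lemma psi0 : psi mu 0 = 0.
Proof.
apply: (addrI 1); rewrite psiE addr0 (_ : f 0 = cst 1) ?int_cst//.
by apply/funext => x; rewrite /f mul0r subr0 invr1.
Qed.

Let fdiff t t' x : t <= t' -> t' <= 0 -> 0 <= x <= L ->
  (t' - t) / (1 - t * L) ^+ 2 * x <= f t' x - f t x <= (t' - t) * x.
Proof.
move=> tt' t'0 xL; have t0 := le_trans tt' t'0.
have /andP[a1 a2] := den t0 xL; have /andP[b1 b2] := den t'0 xL.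
have x0 : 0 <= x by case/andP: xL.
have a0 : 0 < 1 - t * x by lra.
have b0 : 0 < 1 - t' * x by lra.
have c0 : 0 < 1 - t * L by lra.
have tt0 : 0 <= (t' - t) * x by rewrite mulr_ge0// subr_ge0.
have b3 : 1 - t' * x <= 1 - t * L.
  by apply: le_trans a2; rewrite lerB// ler_wpM2r.
have -> : f t' x - f t x = (t' - t) * x * ((1 - t' * x) * (1 - t * x))^-1.
  by rewrite /f; field; rewrite !gt_eqF.
rewrite [X in X <= _ <= _]mulrAC; apply/andP; split.
  rewrite ler_wpM2l// lef_pV2 ?posrE ?mulr_gt0 ?exprn_gt0//.
  by rewrite expr2 ler_pM// ltW.
by rewrite ler_piMr// invf_le1 ?mulr_gt0// mulr_ege1.
Qed.

(** The integrands differ by (t' - t) x / ((1 - t' x) (1 - t x)), with denominator between 1 and (1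
    - t L)^2. The lower bound yields strict monotonicity once the mean is positive, the upper one
    Lipschitz continuity; at t' = 0 both give the slope at 0. *)
Lemma psi_diff t t' : t <= t' -> t' <= 0 ->
  (t' - t) / (1 - t * L) ^+ 2 * m1 <= psi mu t' - psi mu t <= (t' - t) * m1.
Proof.
move=> tt' t'0; have t0 := le_trans tt' t'0.
have fd := fdiff tt' t'0.
have -> : psi mu t' - psi mu t = \int[mu]_x f t' x - \int[mu]_x f t x by rewrite -!psiE; ring.
rewrite lerBrDr lerBlDr -!(intZ sL _ ti) -!(intD sL)//; try exact: tf; last 2 first.
- by apply: tameM ti; exact: tame_cst.
- by apply: tameM ti; exact: tame_cst.
apply/andP; split; apply: (int_le sL); try exact: tf.
- by apply: tameD (tf t0); apply: tameM ti; exact: tame_cst.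
- by move=> x /fd /andP[+ _]; rewrite lerBrDr.
- by apply: tameD (tf t0); apply: tameM ti; exact: tame_cst.
- by move=> x /fd /andP[_]; rewrite lerBlDr.
Qed.

Lemma mean_ge0 : 0 <= m1.
Proof. by rewrite -(int_cst mu 0); apply: (int_le sL) => // [|x /andP[]//]; exact: tame_cst. Qed.

(** The integrand is 1 at the origin and at least (1 - t L)^-1 elsewhere on [0, L]. *)
Lemma psi_ge_atom t : t <= 0 -> atom0 + (1 - atom0) / (1 - t * L) <= 1 + psi mu t.
Proof.
move=> t0; pose I x : R := \1_([set 0] : set (measurableTypeR R)) x.
have tI : tame 0 L I by apply: tame_indic.
have tL : 0 < 1 - t * L by have := mulr_le0_ge0 t0 L0; lra.
have -> : atom0 + (1 - atom0) / (1 - t * L) = (1 - (1 - t * L)^-1) * atom0 + (1 - t * L)^-1 by ring.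
have aI : atom0 = \int[mu]_x I x by rewrite int_indic.
rewrite psiE aI -(intZ sL _ tI) -[X in _ + X](int_cst mu).
rewrite -(intD sL); last 2 first.
- by apply: tameM tI; exact: tame_cst.
- exact: tame_cst.
apply: (int_le sL); last 1 first.
- move=> x xL; rewrite /I indicE; case: (boolP (x \in _)) => /=.
    rewrite inE /= => ->; rewrite /f mulr0 subr0 invr1; lra.
  move=> _; rewrite mulr0 add0r /f; have /andP[a b] := den t0 xL.
  by rewrite lef_pV2 ?posrE//; lra.
- by apply: tameD (tame_cst _ _ _); apply: tameM tI; exact: tame_cst.
- exact: tf.
Qed.

Lemma psi_gt t : atom0 < 1 -> t <= 0 -> atom0 - 1 < psi mu t.
Proof.
move=> a1 t0; have := psi_ge_atom t0.
have : 0 < (1 - atom0) / (1 - t * L).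
  by rewrite divr_gt0 ?subr_gt0//; have := mulr_le0_ge0 t0 L0; lra.
lra.
Qed.

Lemma psi_ge t : atom0 <= 1 -> t <= 0 -> atom0 - 1 <= psi mu t.
Proof.
move=> a1 t0; have := psi_ge_atom t0.
have : 0 <= (1 - atom0) / (1 - t * L).
  by rewrite divr_ge0 ?subr_ge0//; have := mulr_le0_ge0 t0 L0; lra.
lra.
Qed.

(** Continuity from above: the intervals ]0, 1/(n+1)[ decrease to the empty set. Leaving out the
    origin keeps the atom apart. *)
Lemma small_punctured (e : R) : 0 < e ->
  exists2 d : R, 0 < d & fine (mu `]0, d[%classic) < e.
Proof.
move=> e0; pose F (n : nat) : set (measurableTypeR R) := `]0, n.+1%:R^-1[%classic.
have mF n : measurable (F n) by exact: measurable_itv.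
have : mu (F n) @[n --> \oo] --> mu (\bigcap_n F n).
  apply: nonincreasing_cvg_mu => //.
  - by rewrite (le_lt_trans (probability_le1 _ _))// ltry.
  - exact: bigcapT_measurable.
  - move=> m n mn; apply/subsetPset => x; rewrite /F /= !in_itv /= => /andP[-> xn] /=.
    by apply: (lt_le_trans xn); rewrite lef_pV2 ?posrE// ler_nat.
have -> : \bigcap_n F n = set0.
  apply/seteqP; split=> // x Fx; have : F 0%N x by exact: Fx.
  rewrite /F /= in_itv /= => /andP[x0 _].
  have [n _ hn] := near_infty_natSinv_lt (PosNum x0).
  have := Fx n I; rewrite /F /= in_itv /= => /andP[_ xn].
  by have := lt_trans xn (hn n (leqnn n)); rewrite ltxx.
rewrite measure0 => /fine_cvgP[_ /cvgrPdist_lt /(_ _ e0)[n _ hn]].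
exists n.+1%:R^-1; first by rewrite invr_gt0.
have := hn n (leqnn n); rewrite /= sub0r normrN; apply: le_lt_trans.
exact: ler_norm.
Qed.

Lemma psi_lim (e : R) : 0 < e -> exists2 t, t < 0 & psi mu t < atom0 - 1 + e.
Proof.
move=> e0; have e20 : 0 < e / 2 by rewrite divr_gt0.
have [d d0 hd] := small_punctured e20.
pose J : set (measurableTypeR R) := `]0, d[%classic.
have mJ : measurable J by exact: measurable_itv.
(* With t d = - 2 / e the integrand on [d, L] is at most 1 / (1 + 2 / e) <= e / 2; the mass of ]0,
   d[ uses up the other half of e. *)
pose t := - (2 / e / d); have t0 : t < 0 by rewrite oppr_lt0 !divr_gt0.
exists t => //.
pose I x : R := \1_([set 0] : set (measurableTypeR R)) x.
have tI : tame 0 L I by apply: tame_indic.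
pose IJ x : R := \1_J x.
have tJ : tame 0 L IJ by apply: tame_indic.
suff : 1 + psi mu t <= atom0 + fine (mu J) + (1 - t * d)^-1.
  have : (1 - t * d)^-1 <= e / 2.
    have td : t * d = - (2 / e) by rewrite /t; field; rewrite !gt_eqF.
    rewrite td opprK -[leRHS]invrK lef_pV2 ?posrE ?invr_gt0// ?invf_div ?lerDr//.
    by rewrite addr_gt0// divr_gt0.
  by move: hd; rewrite -/J; lra.
have aI : atom0 = \int[mu]_x I x by rewrite int_indic.
rewrite psiE aI -(int_indic mJ) -(intD sL tI tJ).
rewrite -[X in _ + X](int_cst mu) -(intD sL); last 2 first.
- exact: tameD.
- exact: tame_cst.
apply: (int_le sL); first by apply: tf; exact: ltW.
  by apply: tameD (tame_cst _ _ _); exact: tameD.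
move=> x xL; have /andP[a b] := den (ltW t0) xL.
have f1 : f t x <= 1 by rewrite /f invf_le1//; lra.
have td0 : 0 <= (1 - t * d)^-1.
  by rewrite invr_ge0 subr_ge0 (le_trans _ ler01)// mulr_le0_ge0 // ltW.
have I0 : 0 <= I x by rewrite /I indicE.
have J0 : 0 <= IJ x by rewrite /IJ indicE.
have [x0|x0] := eqVneq x 0.
  have : I x = 1 by rewrite /I indicE x0 mem_set.
  lra.
have xp : 0 < x by rewrite lt0r x0; case/andP: xL.
have [xd|dx] := ltP x d.
  have : IJ x = 1 by rewrite /IJ indicE (_ : x \in J)//; rewrite inE /J /= in_itv /= xp xd.
  lra.
suff : f t x <= (1 - t * d)^-1 by lra.
have tdx : t * x <= t * d by rewrite ler_nM2l.
by rewrite /f lef_pV2 ?posrE; have := mulr_le0_ge0 (ltW t0) (ltW d0); lra.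
Qed.
End Psi.

Section Inverse.
Variables (R : realType) (mu : probability (measurableTypeR R) R) (L : R).
Hypotheses (L0 : 0 <= L) (sL : supp mu 0 L) (a1 : atom0 mu < 1).
Implicit Types (t u x z : R).

Let m1 : R := \int[mu]_x x.
Let pdiff t t' := @psi_diff R mu L sL t t'.

(** With mean 0 the upper bound of [psi_diff] would make psi nonnegative on the negative axis,
    whereas [psi_lim] finds a negative value there. *)
Lemma mean_gt0 : 0 < m1.
Proof.
rewrite lt_neqAle (mean_ge0 sL) andbT eq_sym; apply/eqP => m0.
have e0 : 0 < 1 - atom0 mu by rewrite subr_gt0.
have [t t0] := psi_lim sL e0.
have /andP[_] := pdiff (ltW t0) (lexx 0); rewrite -/m1 m0 mulr0 psi0.
lra.
Qed.

Lemma psi_incr t t' : t < t' -> t' <= 0 -> psi mu t < psi mu t'.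
Proof.
move=> tt' t'0; have /andP[h _] := pdiff (ltW tt') t'0.
rewrite -subr_gt0; apply: lt_le_trans h.
have tL : t * L <= 0 by rewrite mulr_le0_ge0// (le_trans (ltW tt')).
apply: mulr_gt0; last exact: mean_gt0.
by rewrite divr_gt0 ?subr_gt0// exprn_gt0//; lra.
Qed.

Lemma psi_lt0 t : t < 0 -> psi mu t < 0.
Proof. by move=> t0; rewrite -(psi0 mu); exact: psi_incr. Qed.

Lemma psi_ltP t t' : t <= 0 -> t' <= 0 -> (psi mu t < psi mu t') = (t < t').
Proof.
move=> t0 t'0; apply/idP/idP => [|tt']; last exact: psi_incr.
apply: contraLR; rewrite -!leNgt le_eqVlt => /orP[/eqP -> //|t't].
exact/ltW/psi_incr.
Qed.

Lemma psi_onto z : atom0 mu - 1 < z < 0 -> exists2 t, t < 0 & psi mu t = z.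
Proof.
move=> /andP[z1 z0].
have e0 : 0 < z - (atom0 mu - 1) by rewrite subr_gt0.
have [t1 t10 ht1] := psi_lim sL e0.
(* To the right of 0 the denominators may vanish; freezing psi there gives a function that is
   Lipschitz on the whole line, as needed for the intermediate value theorem. *)
pose g t := psi mu (Num.min t 0).
have gL t t' : t <= t' -> `|g t' - g t| <= m1 * (t' - t).
  move=> tt'.
  have mm : Num.min t 0 <= Num.min t' 0 by rewrite le_min ge_min tt' ge_min lexx orbT.
  have m0 s : Num.min s (0 : R) <= 0 by rewrite ge_min lexx orbT.
  have /andP[h1 h2] := pdiff mm (m0 t').
  have mi : Num.min t' 0 - Num.min t 0 <= t' - t.
    by rewrite /Num.min; case: ifPn; case: ifPn; rewrite -?leNgt; lra.
  have g0 : 0 <= g t' - g t.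
    apply: le_trans h1; apply: mulr_ge0; last exact: ltW mean_gt0.
    by rewrite divr_ge0 ?subr_ge0// sqr_ge0.
  rewrite ger0_norm//; apply: (le_trans h2); rewrite mulrC.
  by rewrite ler_wpM2l// ltW// mean_gt0.
have gc : continuous g.
  move=> t; apply/cvgrPdist_lt => e ep.
  have d0 : 0 < e / (m1 + 1) by rewrite divr_gt0// addr_gt0// mean_gt0.
  near=> s.
  have st : `|t - s| < e / (m1 + 1).
    by near: s; apply: cvgr_dist_lt => //; exact: cvg_id.
  have : `|g t - g s| <= m1 * `|t - s|.
    have [ts|st'] := leP t s; last by rewrite (gtr0_norm (_ : 0 < t - s)) ?subr_gt0//; exact/gL/ltW.
    by rewrite distrC [X in _ * X]distrC [X in _ * X]ger0_norm ?subr_ge0//; exact: gL.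
  move/le_lt_trans; apply.
  rewrite ltr_pdivlMr ?addr_gt0 ?mean_gt0// in st.
  by apply: le_lt_trans st; rewrite mulrC mulrDr lerDl mulr1.
have gt1 : g t1 = psi mu t1 by rewrite /g min_l// ltW.
have g0 : g 0 = 0 by rewrite /g min_l// psi0.
have [||c] := @IVT R g t1 0 z (ltW t10).
- exact: continuous_subspaceT.
- rewrite gt1 g0 min_l ?max_r; try exact/ltW/psi_lt0.
  by rewrite (ltW z0) andbT; lra.
rewrite in_itv /= => /andP[_ c0]; rewrite /g min_l// => cz; exists c => //.
by rewrite lt_neqAle c0 andbT; apply/eqP => c00; move: cz; rewrite c00 psi0 => z00; move: z0; rewrite -z00 ltxx.
Unshelve. all: by end_near. Qed.

Lemma psi_invK t : t <= 0 -> psi_inv mu (psi mu t) = t.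
Proof.
move=> t0; rewrite /psi_inv; apply: pinvKV; last by rewrite inE /= in_itv.
move=> x y; rewrite !inE /= !in_itv /= => x0 y0 xy.
by apply/eqP; case: ltgtP => // /psi_incr h; [have := h y0|have := h x0]; rewrite xy ltxx.
Qed.

Lemma psi_invP z : atom0 mu - 1 < z < 0 -> psi_inv mu z < 0 /\ psi mu (psi_inv mu z) = z.
Proof.
by move=> /psi_onto [t t0 tz]; rewrite -tz psi_invK// ltW.
Qed.

Lemma psi_inv_gt t z : t <= 0 -> atom0 mu - 1 < z < 0 -> (t < psi_inv mu z) = (psi mu t < z).
Proof.
by move=> t0 /psi_onto [s s0 sz]; rewrite -sz psi_invK ?(ltW s0)// psi_ltP// ltW.
Qed.

Lemma psi_inv_lt t z : t <= 0 -> atom0 mu - 1 < z < 0 -> (psi_inv mu z < t) = (z < psi mu t).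
Proof.
by move=> t0 /psi_onto [s s0 sz]; rewrite -sz psi_invK ?(ltW s0)// psi_ltP// ltW.
Qed.

Lemma S_interior_gt0 z : atom0 mu - 1 < z < 0 -> 0 < S_interior mu z.
Proof.
move=> zz; have [c0 _] := psi_invP zz; have /andP[z1 z0] := zz.
have := atom0_ge0 mu => a0.
by rewrite /S_interior nmulr_rgt0// pmulr_rlt0 ?invr_lt0//; lra.
Qed.

(** For c = psi_inv z, [psi_diff] between c and 0 encloses c / z between 1 / m1 and (1 - c L)^2 /
    m1; the remaining factor 1 + z tends to 1. *)
Lemma S_interior_cvg0 : S_interior mu z @[z --> 0^'-] --> m1^-1.
Proof.
have m0 := mean_gt0.
apply/cvgrPdist_le => e e0.
(* For 0 <= y <= k <= 1 one has (1 + y)^2 <= 1 + 3 y <= 1 + e m1; this is applied to y = - (c L). *)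
pose k := Num.min 1 (e * m1 / 3).
have k0 : 0 < k by rewrite lt_min ltr01 divr_gt0// mulr_gt0.
have k1 : k <= 1 by rewrite ge_min lexx.
have ke : k <= e * m1 / 3 by rewrite ge_min lexx orbT.
have L1 : 0 < L + 1 by rewrite ltr_wpDl.
pose t := - (k / (L + 1)).
have t0 : t < 0 by rewrite oppr_lt0 divr_gt0.
have tL : - (t * L) <= k by rewrite mulNr opprK mulrAC ler_pdivrMr// ler_pM2l// lerDl.
have tz : psi mu t < 0 by exact: psi_lt0.
near=> z.
have z0 : z < 0 by near: z; exact: nbhs_left_lt.
have zt : psi mu t < z by near: z; exact: nbhs_left_gt.
have ze : - (e * m1) < z by near: z; apply: nbhs_left_gt; rewrite oppr_lt0 mulr_gt0.
have zz : atom0 mu - 1 < z < 0 by rewrite z0 andbT (lt_trans _ zt)//; exact: (psi_gt L0 sL a1 (ltW t0)).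
have [c0 cz] := psi_invP zz.
have ct : t < psi_inv mu z by rewrite psi_inv_gt// ltW.
rewrite /S_interior; set c := psi_inv mu z in c0 cz ct *.
have /andP[] := pdiff (ltW c0) (lexx 0); rewrite -/m1 psi0 cz !sub0r.
have cL0 : 0 <= - (c * L) by rewrite oppr_ge0 mulr_le0_ge0// ltW.
have cL : - (c * L) <= k by apply: le_trans tL; rewrite lerN2 ler_wpM2r// ltW.
have D0 : 0 < (1 - c * L) ^+ 2 by rewrite exprn_gt0//; lra.
rewrite mulrAC ler_pdivrMr// => h1 h2.
have z'0 : 0 < - z by rewrite oppr_gt0.
have Se : (z + 1) / z * c = (1 + z) * (- c / - z) by rewrite invrN mulrNN addrC mulrA mulrAC.
have lo : m1^-1 <= - c / - z by rewrite ler_pdivlMr// ler_pdivrMl// mulrC.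
have up : - c / - z <= (1 - c * L) ^+ 2 / m1.
  by rewrite ler_pdivrMr// mulrAC ler_pdivlMr// [leRHS]mulrC.
have up2 : (1 - c * L) ^+ 2 <= 1 + e * m1.
  have : (- (c * L)) ^+ 2 <= - (c * L) by rewrite expr2 ler_piMr//; lra.
  by rewrite !expr2; lra.
have up3 : - c / - z <= m1^-1 + e.
  apply: (le_trans up); rewrite ler_pdivrMr// mulrDl mulVf ?gt_eqF//.
have z1 : 0 < 1 + z.
  have := psi_gt L0 sL a1 (ltW t0); have := atom0_ge0 mu; lra.
have cz0 : 0 <= - c / - z by rewrite divr_ge0// ?oppr_ge0 ltW.
rewrite Se ler_distl; apply/andP; split.
  have : (1 + z) * (- c / - z) <= - c / - z by rewrite ler_piMl//; lra.
  lra.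
have : (1 + z) * m1^-1 <= (1 + z) * (- c / - z) by rewrite ler_pM2l.
have : m1^-1 - e <= (1 + z) * m1^-1.
  rewrite mulrDl mul1r lerD2l ler_pdivlMr//; lra.
lra.
Unshelve. all: by end_near. Qed.

(** [lim] is meaningful only once convergence is known; monotonicity provides it, with +oo allowed.
    Positivity of the limit later excludes the product of 0 and +oo. *)
Lemma S_interior_cvgN1 : atom0 mu = 0 ->
  exists2 l : \bar R, (0 < l)%E & (S_interior mu (-1 + e))%:E @[e --> 0^'+] --> l.
Proof.
move=> a00.
have dom (e : R) : 0 < e < 1 -> atom0 mu - 1 < -1 + e < 0 by rewrite a00; lra.
pose c (e : R) := psi_inv mu (-1 + e).
(* S (-1 + e) = G e / (1 - e), and the integrand of G e is monotone in e *)
pose G (e : R) : R := - c e * e.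
have cP (e : R) : 0 < e < 1 -> c e < 0 /\ 1 + psi mu (c e) = e.
  by move=> /dom /psi_invP [? ->]; split=> //; rewrite addNKr.
have GE (e : R) : 0 < e < 1 -> G e = \int[mu]_x (- c e * (1 - c e * x)^-1).
  move=> e01; have [c0 ce] := cP _ e01.
  rewrite (intZ sL); last exact/tame_resolvent/ltW.
  by rewrite /G; congr (_ * _); rewrite -[LHS]ce /psi addrC subrK.
have Gni : {in `]0, 1[ &, nonincreasing_fun G}.
  move=> e e'; rewrite !in_itv /= => e01 e'01; rewrite le_eqVlt => /orP[/eqP -> //|ee'].
  have [c0 ce] := cP _ e01; have [c'0 ce'] := cP _ e'01.
  have cc' : c e < c e'.
    by rewrite psi_inv_gt ?(ltW c0)// ?dom//; move: ce; lra.
  rewrite !GE//; apply: (int_le sL).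
  - by apply: tameM; [exact: tame_cst|exact/tame_resolvent/ltW].
  - by apply: tameM; [exact: tame_cst|exact/tame_resolvent/ltW].
  (* With s = - c e the integrand is s / (1 + s x), which increases with s, while s decreases as e
     grows. *)
  move=> x /andP[x0 _].
  have d : 0 < 1 - c e * x by have := mulr_le0_ge0 (ltW c0) x0; lra.
  have d' : 0 < 1 - c e' * x by have := mulr_le0_ge0 (ltW c'0) x0; lra.
  by rewrite ler_pdivrMr// mulrAC ler_pdivlMr//; lra.
have cvG : (G e)%:E @[e --> 0^'+] --> ereal_sup ((EFin \o G) @` `]0, 1[%classic).
  apply: (@nonincreasing_at_right_cvge _ (EFin \o G) 0 (BLeft 1)); first by rewrite bnd_simp.
  by move=> e e' ? ? ?; rewrite /= lee_fin; exact: Gni.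
set l := ereal_sup _ in cvG.
have l0 : (0 < l)%E.
  have h : (0 < 2^-1 :> R) && (2^-1 < 1 :> R) by lra.
  apply: (@lt_le_trans _ _ (G 2^-1)%:E).
    by rewrite lte_fin mulr_gt0// ?invr_gt0// oppr_gt0; have [] := cP _ h.
  by apply: ereal_sup_ubound; exists 2^-1 => //=; rewrite in_itv.
exists l => //.
have cv1 : ((1 - e)^-1)%:E @[e --> (0:R)^'+] --> (1%:E : \bar R).
  apply: cvg_EFin; first by near=> e.
  rewrite -[X in _ --> X]invr1; apply: cvgV; first exact: oner_neq0.
  rewrite -[X in _ --> X]subr0; apply: cvgB; first exact: cvg_cst.
  by apply: cvg_at_right_filter; exact: cvg_id.
have sup1 : (l *? 1)%E by apply: neq0_mule_def; rewrite mule1 gt_eqF.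
have h := cvgeM sup1 cvG cv1; rewrite mule1 in h.
suff E : \forall e \near (0 : R)^'+, ((G e)%:E * ((1 - e)^-1)%:E)%E = (S_interior mu (-1 + e))%:E.
  apply: cvg_trans; last exact: h.
  exact: near_eq_cvg E.
near=> e.
have e01 : 0 < e < 1 by apply/andP; split; near: e; [exact: nbhs_right_gt|exact: nbhs_right_lt].
rewrite /= -EFinM; congr (_%:E); rewrite /S_interior /G -/(c e).
by field; apply/andP; split; lra.
Unshelve. all: by end_near. Qed.
End Inverse.

(** * Values of the S-transform *)

Section Values.
Variables (R : realType) (mu : probability (measurableTypeR R) R) (L : R).
Hypotheses (L0 : 0 <= L) (sL : supp mu 0 L) (a1 : atom0 mu < 1).
Implicit Types (s : R).

Lemma S_transform0 : S_transform mu 0 = ((\int[mu]_x x)^-1)%:E.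
Proof.
rewrite /S_transform eqxx; apply/cvg_lim; first exact: ereal_hausdorff.
by apply: cvg_EFin; [near=> z|exact: (S_interior_cvg0 L0 sL a1)].
Unshelve. all: by end_near. Qed.

Lemma S_transform_fin s : atom0 mu - 1 < s < 0 -> S_transform mu s = (S_interior mu s)%:E.
Proof.
move=> /andP[s1 s0]; have a0 := atom0_ge0 mu.
rewrite /S_transform lt_eqF// (gt_eqF (_ : -1 < s)) /=; last by lra.
by rewrite atom0E -EFinB lte_fin s1.
Qed.

Lemma S_transform_infty s : 0 < atom0 mu -> s <= atom0 mu - 1 -> S_transform mu s = +oo%E.
Proof.
move=> a0 s1; rewrite /S_transform lt_eqF; last by move: a1; lra.
rewrite atom0E eqe (gt_eqF a0) andbF -EFinB lte_fin ltNge s1//.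
Qed.

Lemma S_transformN1 : atom0 mu = 0 ->
  (0 < S_transform mu (-1))%E /\
  (S_interior mu (-1 + e))%:E @[e --> 0^'+] --> S_transform mu (-1).
Proof.
move=> a0; have [l l0 cl] := S_interior_cvgN1 L0 sL a1 a0.
rewrite /S_transform atom0E a0 !eqxx /= oppr_eq0 oner_eq0.
by have -> := cvg_lim (@ereal_hausdorff R) cl.
Qed.

Lemma S_transform_gt0 s : -1 <= s <= 0 -> (0 < S_transform mu s)%E.
Proof.
move=> /andP[s1 s0]; have a0 := atom0_ge0 mu.
have [->|sn0] := eqVneq s 0.
  by rewrite S_transform0 lte_fin invr_gt0 (mean_gt0 sL a1).
have {}s0 : s < 0 by rewrite lt_neqAle sn0.
have [sa|sa] := ltP (atom0 mu - 1) s.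
  by rewrite S_transform_fin ?sa// lte_fin (S_interior_gt0 L0 sL a1)// sa.
have [a00|an0] := eqVneq (atom0 mu) 0.
  have -> : s = -1 by lra.
  by have [] := S_transformN1 a00.
by rewrite S_transform_infty// lt_neqAle eq_sym an0.
Qed.
End Values.

Lemma not_dirac0_atom (R : realType) (mu : probability (measurableTypeR R) R) :
  ~ is_dirac0 mu -> atom0 mu < 1.
Proof.
move=> nd; have m0 : measurable ([set 0] : set (measurableTypeR R)) by exact: measurable_set1.
have : atom0 mu <= 1 by rewrite -lee_fin -atom0E; exact: probability_le1.
rewrite le_eqVlt => /orP[/eqP a1|//]; exfalso; apply: nd => A mA.
have mu0 : mu [set 0] = 1%E by rewrite atom0E a1.
rewrite diracE; case: (boolP (0 \in A)); rewrite ?inE ?notin_setE => A0.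
  apply/eqP; rewrite eq_le probability_le1//= -mu0.
  by apply: le_measure; rewrite ?inE// => x ->.
apply/eqP; rewrite -measure_le0.
have <- : mu (~` [set 0]) = 0%E.
  by rewrite probability_setC// mu0 subee.
apply: le_measure; rewrite ?inE//; first exact: measurableC.
by move=> x Ax x0; apply: A0; rewrite -x0.
Qed.

(** * From the relation between the psi functions to the S-transforms *)

Section Multiplicative.
Variables (R : realType) (mu nu rho : probability (measurableTypeR R) R) (L K M : R).
Hypotheses (L0 : 0 <= L) (sL : supp mu 0 L) (a1 : atom0 mu < 1).
Hypotheses (K0 : 0 <= K) (sK : supp nu 0 K) (b1 : atom0 nu < 1).
Hypotheses (M0 : 0 <= M) (sM : supp rho 0 M).
Hypothesis rel : forall u v z : R, -1 < z -> z < 0 -> u < 0 -> v < 0 ->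
  psi mu u = z -> psi nu v = z -> psi rho ((1 + z) / z * u * v) = z.
Variable m : R.
Hypothesis mE : m = Num.max (atom0 mu) (atom0 nu).
Implicit Types z s : R.

Let a0 := atom0_ge0 mu. Let b0 := atom0_ge0 nu. Let c0 := atom0_ge0 rho.
Let ma : atom0 mu <= m. Proof. by rewrite mE le_max lexx. Qed.
Let mb : atom0 nu <= m. Proof. by rewrite mE le_max lexx orbT. Qed.
Let m1 : m < 1. Proof. by rewrite mE gt_max a1. Qed.

Let w z := (1 + z) / z * psi_inv mu z * psi_inv nu z.

Let wP z : m - 1 < z < 0 -> w z < 0 /\ psi rho (w z) = z.
Proof.
move=> /andP[z1 z0].
have za : atom0 mu - 1 < z < 0 by rewrite z0 andbT; apply: le_lt_trans z1; rewrite lerD2r.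
have zb : atom0 nu - 1 < z < 0 by rewrite z0 andbT; apply: le_lt_trans z1; rewrite lerD2r.
have [u0 uz] := psi_invP L0 sL a1 za; have [v0 vz] := psi_invP K0 sK b1 zb.
have zN1 : -1 < z by case/andP: za => + _; move: a0; lra.
split; last exact: rel.
by rewrite /w nmulr_llt0// nmulr_lgt0// pmulr_rlt0 ?invr_lt0//; lra.
Qed.

(** Every z in ]m - 1, 0[ is a value of psi rho on the negative axis, where psi rho stays above
    atom0 rho - 1. That atom0 rho < 1 is a consequence, so only the weak bound [psi_ge] is available
    here. *)
Lemma rho_atom_le : atom0 rho <= m.
Proof.
rewrite leNgt; apply/negP => mr.
have r1 : atom0 rho <= 1 by rewrite -lee_fin -atom0E; exact: probability_le1.
pose z := (m + Num.min (atom0 rho) 1) / 2 - 1.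
have zz : m - 1 < z < 0 by rewrite /z min_l//; move: m1 mr r1; lra.
have [w0 wz] := wP zz.
have := psi_ge M0 sM r1 (ltW w0); rewrite wz /z min_l//; move: mr; lra.
Qed.

Let c1 : atom0 rho < 1. Proof. exact: le_lt_trans rho_atom_le m1. Qed.

(* Otherwise m - 1 is a value of psi rho at some t0 < 0, but w z tends to -oo as
   z decreases to m - 1 because psi_inv mu1 does. *)
Let rho_atom_ge_aux (mu1 mu2 : probability (measurableTypeR R) R) (L1 L2 : R) :
  0 <= L1 -> supp mu1 0 L1 -> atom0 mu1 < 1 ->
  0 <= L2 -> supp mu2 0 L2 -> atom0 mu2 < 1 ->
  m = atom0 mu1 -> atom0 mu2 <= m ->
  (forall z, w z = (1 + z) / z * psi_inv mu1 z * psi_inv mu2 z) -> m <= atom0 rho.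
Proof.
move=> L10 s1 a11 L20 s2 a21 me m2 we; rewrite leNgt; apply/negP => rm.
have mp : 0 < m by apply: le_lt_trans rm.
have dom : atom0 rho - 1 < m - 1 < 0 by move: m1 rm; lra.
have [t0 t00 tm] := psi_onto M0 sM c1 dom.
(* A fixed point of ]m - 1, 0[: for z < z1 the value psi_inv mu2 z stays below - v1, away from 0. *)
pose z1 := (m - 1) / 2.
have z1d : atom0 mu2 - 1 < z1 < 0 by move: m1 m2; rewrite /z1; lra.
have [v0 _] := psi_invP L20 s2 a21 z1d.
pose v1 := - psi_inv mu2 z1; have v1p : 0 < v1 by rewrite oppr_gt0.
(* Chosen so that m (- t) v1 = - t0. For z close to m - 1 the three factors of - w z exceed or equal
   m, - t and v1 respectively, hence w z < t0. *)
pose t := t0 / (m * v1).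
have tn : t < 0 by rewrite pmulr_llt0// invr_gt0 mulr_gt0.
have pt : m - 1 < psi mu1 t by rewrite me; exact: (psi_gt L10 s1 a11 (ltW tn)).
have [z /andP[zm zlt]] : exists z, m - 1 < z < Num.min z1 (psi mu1 t).
  exists ((m - 1 + Num.min z1 (psi mu1 t)) / 2).
  have : m - 1 < Num.min z1 (psi mu1 t) by rewrite lt_min pt andbT /z1; move: m1; lra.
  lra.
move: zlt; rewrite lt_min => /andP[zz1 zt].
have z0 : z < 0 by case/andP: z1d => _; exact: lt_trans.
have zd1 : atom0 mu1 - 1 < z < 0 by rewrite -me zm.
have zd2 : atom0 mu2 - 1 < z < 0 by rewrite z0 andbT; apply: le_lt_trans zm; rewrite lerD2r.
have ult : psi_inv mu1 z < t by rewrite (psi_inv_lt L10 s1 a11)// ltW.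
have [u0 _] := psi_invP L10 s1 a11 zd1.
have [v20 vz] := psi_invP L20 s2 a21 zd2.
have vlt : psi_inv mu2 z < psi_inv mu2 z1.
  by rewrite (psi_inv_lt L20 s2 a21) ?(ltW v0)//; have [_ ->] := psi_invP L20 s2 a21 z1d.
have zmd : m - 1 < z < 0 by rewrite zm.
have [w0 wz] := wP zmd.
have wt0 : w z < t0.
  rewrite we.
  have e : t0 = - (m * (- t * v1)).
    by rewrite /t; field; rewrite !gt_eqF.
  have q1 : m <= (1 + z) / - z.
    rewrite ler_pdivlMr ?oppr_gt0//; have : m * - z <= m * 1 by rewrite ler_wpM2l ?(ltW mp)//; move: m1 zm mp; lra.
    by move: zm mp; lra.
  have q2 : - t * v1 < psi_inv mu1 z * psi_inv mu2 z.
    rewrite -[ltRHS]mulrNN; apply: ltr_pM.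
    - by rewrite oppr_ge0 ltW.
    - exact: ltW.
    - by rewrite ltrN2.
    - by rewrite /v1 ltrN2.
  have -> : (1 + z) / z * psi_inv mu1 z * psi_inv mu2 z =
      - ((1 + z) / - z * (psi_inv mu1 z * psi_inv mu2 z)).
    by rewrite invrN; ring.
  rewrite e ltrN2; have p0 : 0 < - t * v1 by rewrite mulr_gt0// oppr_gt0.
  apply: (@lt_le_trans _ _ (m * (psi_inv mu1 z * psi_inv mu2 z))).
    by rewrite ltr_pM2l.
  by rewrite ler_wpM2r// (le_trans (ltW p0))// ltW.
have := psi_incr M0 sM c1 wt0 (ltW t00); rewrite wz tm => /lt_trans/(_ zm).
by rewrite ltxx.
Qed.

Lemma rho_atom : atom0 rho = m.
Proof.
apply/eqP; rewrite eq_le rho_atom_le /=.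
have [ab|ba] := leP (atom0 nu) (atom0 mu).
  apply: (rho_atom_ge_aux L0 sL a1 K0 sK b1) => //.
  by rewrite mE max_l.
apply: (rho_atom_ge_aux K0 sK b1 L0 sL a1) => //.
  by rewrite mE max_r// ltW.
by move=> z; rewrite /w mulrAC.
Qed.

Lemma S_interior_mul z : m - 1 < z < 0 ->
  S_interior mu z * S_interior nu z = S_interior rho z.
Proof.
move=> zz; have [w0 wz] := wP zz.
have e : psi_inv rho z = w z by rewrite -{1}wz (psi_invK M0 sM c1)// ltW.
by rewrite /S_interior e /w; ring.
Qed.

Lemma S_transform_mul s : -1 <= s <= 0 ->
  (S_transform mu s * S_transform nu s)%E = S_transform rho s.
Proof.
move=> /andP[sN1 s0]; have rm := rho_atom.
have posA : (0 < S_transform mu s)%E by apply: (S_transform_gt0 L0 sL a1); rewrite sN1.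
have posB : (0 < S_transform nu s)%E by apply: (S_transform_gt0 K0 sK b1); rewrite sN1.
have [se|sn0] := eqVneq s 0.
  rewrite se (S_transform0 L0 sL a1) (S_transform0 K0 sK b1) (S_transform0 M0 sM c1) -EFinM.
  congr (_%:E).
  have cA := S_interior_cvg0 L0 sL a1.
  have cB := S_interior_cvg0 K0 sK b1.
  have cR := S_interior_cvg0 M0 sM c1.
  have cAB := cvgM cA cB.
  suff cR2 : S_interior rho z @[z --> 0^'-] --> (\int[mu]_x x)^-1 * (\int[nu]_x x)^-1.
    exact: (cvg_unique _ cR2 cR).
  apply: cvg_trans; last exact: cAB.
  apply: near_eq_cvg; near=> z; apply: S_interior_mul.
  apply/andP; split; near: z; last exact: nbhs_left_lt.
  by apply: nbhs_left_gt; rewrite subr_lt0.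
have {}s0 : s < 0 by rewrite lt_neqAle sn0.
have [sm|sm] := ltP (m - 1) s.
  have sa : atom0 mu - 1 < s < 0 by rewrite s0 andbT; apply: le_lt_trans sm; rewrite lerD2r.
  have sb : atom0 nu - 1 < s < 0 by rewrite s0 andbT; apply: le_lt_trans sm; rewrite lerD2r.
  rewrite !S_transform_fin ?sa ?sb ?rm ?sm// -EFinM S_interior_mul// sm//.
have [m0|mn0] := eqVneq m 0.
  have se : s = -1 by move: sm; rewrite m0; lra.
  have a00 : atom0 mu = 0 by move: ma a0; rewrite m0; lra.
  have b00 : atom0 nu = 0 by move: mb b0; rewrite m0; lra.
  have c00 : atom0 rho = 0 by rewrite rm.
  rewrite se in posA posB *.
  have [_ cA] := S_transformN1 L0 sL a1 a00.
  have [_ cB] := S_transformN1 K0 sK b1 b00.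
  have [_ cR] := S_transformN1 M0 sM c1 c00.
  have ABn : (S_transform mu (-1) * S_transform nu (-1) != 0)%E.
    by rewrite gt_eqF// mule_gt0.
  have cAB := cvgeM (neq0_mule_def ABn) cA cB.
  suff cR2 : (S_interior rho (-1 + e))%:E @[e --> 0^'+] --> (S_transform mu (-1) * S_transform nu (-1))%E.
    exact: (cvg_unique _ cR2 cR).
  apply: cvg_trans; last exact: cAB.
  apply: near_eq_cvg; near=> e; rewrite /= -EFinM S_interior_mul//.
  have e1 : e < 1 by near: e; exact: nbhs_right_lt.
  have e0 : 0 < e by near: e; exact: nbhs_right_gt.
  by rewrite m0; lra.
(* Now s is at or below the level of the larger atom: the corresponding factor is +oo and the other
   one is positive, so the product is +oo. *)
have mp : 0 < m by rewrite lt_neqAle eq_sym mn0 (le_trans a0).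
rewrite [RHS](S_transform_infty (mu := rho))//; try by rewrite rm.
have [ab|ba] := leP (atom0 nu) (atom0 mu).
  have e : m = atom0 mu by rewrite mE max_l.
  by rewrite (S_transform_infty (mu := mu)) -?e// gt0_mulye.
have e : m = atom0 nu by rewrite mE max_r// ltW.
by rewrite (S_transform_infty (mu := nu)) -?e// gt0_muley.
Unshelve. all: by end_near. Qed.
End Multiplicative.

(** * The algebra and its trace *)

Section FixedAlgebra.
Local Open Scope complex_scope.
Variables (R : realType) (W : tracial_space R).
Local Notation H := (wp_space W).
Local Notation C := (R[i]).
Local Notation M := (@wp_alg R W).
Local Notation ip := (wp_dotp W).

Lemma vn_usa : unital_star_algebra ip M.
Proof. by have [] := wp_vN W. Qed.

(** Membership is bundled because composition distributes over sums on the right only for linear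
    maps; the bundled operators form a genuine C-algebra. *)
Record vnop := VNop { vnop_fun :> H -> H ; vnopP : M vnop_fun }.

HB.instance Definition _ := gen_eqMixin vnop.
HB.instance Definition _ := gen_choiceMixin vnop.

Lemma vnop_eq (S T : vnop) : (S : H -> H) =1 T -> S = T.
Proof.
case: S T => [S MS] [T MT] /= /funext ST; move: MS MT; rewrite ST => MS MT.
by congr VNop; exact: Prop_irrelevance.
Qed.

Lemma vnop_linear (T : vnop) : linear T.
Proof. by have [] := usa_bounded vn_usa (vnopP T). Qed.

HB.instance Definition _ (T : vnop) :=
  GRing.isLinear.Build C H H *:%R (T : H -> H) (@vnop_linear T).

Lemma vn_zero : M (cst 0).
Proof.
have := usa_lin vn_usa (-1) (usa_one vn_usa) (usa_one vn_usa).
by congr M; apply/funext => x /=; rewrite /GRing.add /= /GRing.scale /= scaleN1r addNr.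
Qed.
Lemma vn_scale (c : C) T : M T -> M (c *: T).
Proof.
by move=> MT; have := usa_lin vn_usa c MT vn_zero; congr M; apply/funext => x /=; rewrite /GRing.add /= addr0.
Qed.
Lemma vn_add S T : M S -> M T -> M (S + T).
Proof.
by move=> MS MT; have := usa_lin vn_usa 1 MS MT; rewrite scale1r.
Qed.
Lemma vn_comp S T : M S -> M T -> M (S \o T).
Proof. by move=> MS MT; apply: (usa_comp vn_usa). Qed.

Definition vnop0 := VNop vn_zero.
Definition vnop1 := VNop (usa_one vn_usa).
Definition vnop_add (S T : vnop) := VNop (vn_add (vnopP S) (vnopP T)).
Definition vnop_scale (c : C) (T : vnop) := VNop (vn_scale c (vnopP T)).
Definition vnop_opp := vnop_scale (-1).
Definition vnop_mul (S T : vnop) := VNop (vn_comp (vnopP S) (vnopP T)).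

Fact vnop_addA : associative vnop_add.
Proof. by move=> S T U; apply: vnop_eq => x; exact: addrA. Qed.
Fact vnop_addC : commutative vnop_add.
Proof. by move=> S T; apply: vnop_eq => x; exact: addrC. Qed.
Fact vnop_add0 : left_id vnop0 vnop_add.
Proof. by move=> S; apply: vnop_eq => x; exact: add0r. Qed.
Fact vnop_addN : left_inverse vnop0 vnop_opp vnop_add.
Proof. by move=> S; apply: vnop_eq => x; rewrite /= /GRing.add /GRing.scale /= scaleN1r addNr. Qed.
HB.instance Definition _ :=
  GRing.isZmodule.Build vnop vnop_addA vnop_addC vnop_add0 vnop_addN.

Fact vnop_mulA : associative vnop_mul.
Proof. by move=> S T U; apply: vnop_eq. Qed.
Fact vnop_mul1 : left_id vnop1 vnop_mul.
Proof. by move=> S; apply: vnop_eq. Qed.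
Fact vnop_mulr1 : right_id vnop1 vnop_mul.
Proof. by move=> S; apply: vnop_eq. Qed.
Fact vnop_mulDl : left_distributive vnop_mul vnop_add.
Proof. by move=> S T U; apply: vnop_eq. Qed.
Fact vnop_mulDr : right_distributive vnop_mul vnop_add.
Proof. by move=> S T U; apply: vnop_eq => x /=; exact: linearD. Qed.
(** The state excludes the zero algebra: 1 = 0 would give tau 1 = tau 1 + tau 1 although tau 1 =
    1. *)
Fact vnop_1neq0 : vnop1 != 0.
Proof.
apply/eqP => /(congr1 vnop_fun) /= e.
have := state_lin (wp_state W) 1 vn_zero vn_zero.
have -> : (1 : C) *: cst (0 : H) + cst 0 = idfun.
  by rewrite e; apply/funext => x; rewrite /GRing.add /GRing.scale /= scaler0 addr0.
have <- : idfun = cst (0 : H) by rewrite e.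
rewrite (state_one (wp_state W)) mul1r => /eqP.
by rewrite -subr_eq0 opprD addNKr oppr_eq0 oner_eq0.
Qed.
HB.instance Definition _ := GRing.Zmodule_isNzRing.Build vnop
  vnop_mulA vnop_mul1 vnop_mulr1 vnop_mulDl vnop_mulDr vnop_1neq0.

Fact vnop_scaleA (a b : C) T :
  vnop_scale a (vnop_scale b T) = vnop_scale (a * b) T.
Proof. by apply: vnop_eq => x; exact: scalerA. Qed.
Fact vnop_scale1 : left_id 1 vnop_scale.
Proof. by move=> S; apply: vnop_eq => x; exact: scale1r. Qed.
Fact vnop_scaleDr : right_distributive vnop_scale +%R.
Proof. by move=> c S T; apply: vnop_eq => x; exact: scalerDr. Qed.
Fact vnop_scaleDl T : {morph vnop_scale^~ T : a b / a + b}.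
Proof. by move=> a b; apply: vnop_eq => x; exact: scalerDl. Qed.
HB.instance Definition _ := GRing.Zmodule_isLmodule.Build C vnop
  vnop_scaleA vnop_scale1 vnop_scaleDr vnop_scaleDl.

Fact vnop_scaleAl (a : C) (S T : vnop) : a *: (S * T) = a *: S * T.
Proof. exact: vnop_eq. Qed.
HB.instance Definition _ := GRing.Lmodule_isLalgebra.Build C vnop vnop_scaleAl.
Fact vnop_scaleAr (a : C) (S T : vnop) : a *: (S * T) = S * (a *: T).
Proof. by apply: vnop_eq => x; rewrite /= linearZ. Qed.
HB.instance Definition _ := GRing.Lalgebra_isAlgebra.Build C vnop vnop_scaleAr.

Definition tau (T : vnop) : C := wp_tr T.
Fact tau_is_scalar : scalar tau.
Proof. by move=> c S T; exact: (state_lin (wp_state W) c (vnopP S) (vnopP T)). Qed.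
HB.instance Definition _ := GRing.isLinear.Build C vnop C _ tau tau_is_scalar.

Lemma vnopDE (S T : vnop) x : (S + T) x = S x + T x. Proof. by []. Qed.
Lemma vnopZE (c : C) (T : vnop) x : (c *: T) x = c *: T x. Proof. by []. Qed.
Lemma vnopNE (T : vnop) x : (- T) x = - T x.
Proof. exact: (scaleN1r (T x)). Qed.
Lemma vnopME (S T : vnop) x : (S * T) x = S (T x). Proof. by []. Qed.
Lemma vnop1E x : (1 : vnop) x = x. Proof. by []. Qed.
Lemma vnop0E x : (0 : vnop) x = 0. Proof. by []. Qed.

Lemma tau1 : tau 1 = 1. Proof. exact: (state_one (wp_state W)). Qed.
Lemma tau_mulC (S T : vnop) : tau (S * T) = tau (T * S).
Proof. exact: (state_tracial (wp_state W) (vnopP S) (vnopP T)). Qed.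

(** Adjoints stay a relation: their existence is an axiom of the algebra, and a chosen witness
    suffices wherever one is needed. *)
Definition adj (S T : vnop) := adjoint_op ip S T.
Definition pos (T : vnop) := op_ge0 ip T.

Lemma ex_adj (T : vnop) : exists T', adj T T'.
Proof. by have [T' MT' TT'] := usa_adj vn_usa (vnopP T); exists (VNop MT'). Qed.

Lemma ip_ge0 x : 0 <= ip x x.
Proof. exact: dnorm_ge0. Qed.
Lemma posE (T : vnop) : pos T <-> forall x, 0 <= ip (T x) x.
Proof. by split=> h x; have := h x; rewrite /= linear0l. Qed.
Lemma tau_ge0 T : pos T -> 0 <= tau T.
Proof. exact: (state_ge0 (wp_state W) (vnopP T)). Qed.
Lemma tau_eq0 T : pos T -> tau T = 0 -> T = 0.
Proof.
move=> pT tT; apply: vnop_eq => x.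
by rewrite (state_faithful (wp_state W) (vnopP T) pT tT).
Qed.
End FixedAlgebra.

(** * Adjoints, Cauchy-Schwarz for the trace, operator bounds *)

Section Bounds.
Local Open Scope complex_scope.
Variables (R : realType) (W : tracial_space R).
Local Notation H := (wp_space W).
Local Notation C := (R[i]).
Local Notation ip := (wp_dotp W).
Implicit Types (S T : vnop W) (x y : H).

Lemma ipCn x y : ip x y = Num.conj (ip y x).
Proof. by rewrite (hermC ip) expr0 mul1r. Qed.

Lemma ipZl (c : C) x y : ip (c *: x) y = c * ip x y.
Proof. exact: linearZl_LR. Qed.
Lemma ipZr (c : C) x y : ip x (c *: y) = Num.conj c * ip x y.
Proof. exact: linearZr_LR. Qed.
Lemma ipDl x y z : ip (x + y) z = ip x z + ip y z.
Proof. exact: linearDl. Qed.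
Lemma ipDr x y z : ip z (x + y) = ip z x + ip z y.
Proof. exact: linearDr. Qed.
Lemma ipBl x y z : ip (x - y) z = ip x z - ip y z.
Proof. exact: linearBl. Qed.
Lemma ipBr x y z : ip z (x - y) = ip z x - ip z y.
Proof. exact: linearBr. Qed.
Lemma vnopD T x y : T (x + y) = T x + T y.
Proof. exact: linearD. Qed.
Lemma vnopZ T (c : C) x : T (c *: x) = c *: T x.
Proof. exact: linearZ. Qed.
(** Expanding at x + y gives D x y + D y x = 0, at x + i y it gives D y x = D x y; complex scalars
    are essential. *)
Lemma polarization (D : H -> H -> C) :
  (forall x, D x x = 0) ->
  (forall x y z, D (x + y) z = D x z + D y z) ->
  (forall x y z, D z (x + y) = D z x + D z y) ->
  (forall (c : C) x y, D (c *: x) y = c * D x y) ->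
  (forall (c : C) x y, D x (c *: y) = Num.conj c * D x y) ->
  forall x y, D x y = 0.
Proof.
move=> D0 Dl Dr Zl Zr x y.
have h1 : D x y + D y x = 0.
  by have := D0 (x + y); rewrite Dl !Dr !D0 add0r addr0.
have h2 : - D x y + D y x = 0.
  have := D0 (x + 'i%R *: y); rewrite Dl !Dr !D0 Zl Zr add0r addr0.
  rewrite conjCi mulNr -mulrN -mulrDr => /eqP; rewrite mulf_eq0.
  by rewrite (negPf (neq0Ci _)) /= => /eqP.
have : 2 * D y x = 0.
  by rewrite mulr_natl mulr2n -{1}[D y x](addKr (D x y)) h1 addr0 h2.
move=> /eqP; rewrite mulf_eq0 pnatr_eq0 /= => /eqP D0'.
by move: h1; rewrite D0' addr0.
Qed.

(** Nonnegative numbers of R[i] are real, so the defect of symmetry vanishes on the diagonal. *)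
Lemma pos_adj T : pos T -> adj T T.
Proof.
move=> /posE pT x y; apply/eqP; rewrite -subr_eq0; apply/eqP; move: x y.
apply: (polarization (D := fun x y => ip (T x) y - ip x (T y))) => /=.
- move=> x; rewrite [ip x (T x)]ipCn conj_Creal ?subrr// ger0_real//.
- by move=> x y z; rewrite vnopD !ipDl; ring.
- by move=> x y z; rewrite vnopD !ipDr; ring.
- by move=> c x y; rewrite vnopZ !ipZl mulrBr.
- by move=> c x y; rewrite vnopZ !ipZr mulrBr.
Qed.

Lemma adjM S S' T T' : adj S S' -> adj T T' -> adj (S * T) (T' * S').
Proof. by move=> a b x y; rewrite !vnopME a b. Qed.
Lemma adjD S S' T T' : adj S S' -> adj T T' -> adj (S + T) (S' + T').
Proof. by move=> a b x y; rewrite !vnopDE ipDl ipDr a b. Qed.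
Lemma adjZ (c : C) T T' : adj T T' -> adj (c *: T) (Num.conj c *: T').
Proof. by move=> a x y; rewrite !vnopZE ipZl ipZr conjCK a. Qed.
Lemma adj1 : adj (1 : vnop W) 1. Proof. by []. Qed.
Lemma adjB S S' T T' : adj S S' -> adj T T' -> adj (S - T) (S' - T').
Proof. 
move=> a b; rewrite -![- (_ : vnop W)]scaleN1r.
apply: adjD => //.
by have := adjZ (-1) b; rewrite rmorphN1.
Qed.
Lemma adj_sym S T : adj S T -> adj T S.
Proof. by move=> a x y; rewrite ipCn -a -ipCn. Qed.
Lemma adj_pos S S' : adj S S' -> pos (S * S').
Proof. by move=> a; apply/posE => x; rewrite vnopME a ip_ge0. Qed.
Lemma pos_conj T U : pos T -> adj U U -> pos (U * T * U).
Proof. by move=> /posE pT a; apply/posE => x; rewrite !vnopME a. Qed.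

(** Discriminant argument: t = 1 / g minimizes the quadratic; when g = 0 it is affine, and the
    chosen t would make it equal to -1 if b2 were positive. *)
Lemma CS_aux (a b2 g : R) : 0 <= a -> 0 <= b2 -> 0 <= g ->
  (forall t, 0 <= a - 2 * t * b2 + t ^+ 2 * b2 * g) -> b2 <= a * g.
Proof.
move=> a0 b0 g0 h; have [g00|gn] := eqVneq g 0.
  have [->|bn] := eqVneq b2 0; first by rewrite mulr_ge0.
  have bp : 0 < b2 by rewrite lt0r bn.
  have := h ((a + 1) / (2 * b2)); rewrite g00 mulr0 addr0.
  have -> : 2 * ((a + 1) / (2 * b2)) * b2 = a + 1 by field.
  by lra.
have gp : 0 < g by rewrite lt0r gn.
have := h (g^-1).
have -> : a - 2 * g^-1 * b2 + g^-1 ^+ 2 * b2 * g = (a * g - b2) / g by field.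
by rewrite pmulr_lge0 ?invr_gt0// subr_ge0.
Qed.

Section CS.
Variables (S S' T T' : vnop W).
Hypotheses (aS : adj S S') (aT : adj T T').
Let al := tau (S * S'). Let ga := tau (T' * T).
Let be := tau (S * T). Let be' := tau (T' * S').

(** Positivity of [tau] on the product of S + k T' with its adjoint, expanded. *)
Let quad (k : C) : 0 <= al + Num.conj k * be + k * be' + (k * Num.conj k) * ga.
Proof.
have h := tau_ge0 (adj_pos (adjD aS (adjZ k (adj_sym aT)))).
rewrite mulrDl !mulrDr -!scalerAl -!scalerAr !linearD /= !linearZ /= in h.
by move: h; rewrite /al /be /be' /ga; congr (_ <= _); ring.
Qed.

(** Hermitian symmetry is derived from positivity: k = 1 and k = i in [quad] show that be + be' and
    i (be' - be) are real. *)
Lemma tau_adj2 : tau (T' * S') = Num.conj (tau (S * T)).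
Proof.
have al0 : al \is Num.real by apply/ger0_real/tau_ge0/adj_pos.
have ga0 : ga \is Num.real by apply/ger0_real/tau_ge0/adj_pos/adj_sym.
have h1 : be + be' \is Num.real.
  have /ger0_real := quad 1; rewrite rmorph1 !mul1r.
  have -> : al + be + be' + ga = (be + be') + (al + ga) by ring.
  by rewrite rpredDr// realD.
have h2 : 'i%R * (be' - be) \is Num.real.
  have /ger0_real := quad 'i%R; rewrite conjCi mulrN -expr2 sqrCi opprK mul1r.
  have -> : al + - 'i%R * be + 'i%R * be' + ga = 'i%R * (be' - be) + (al + ga) by ring.
  by rewrite rpredDr// realD.
have {}h1 : Num.conj be + Num.conj be' = be + be'.
  by rewrite -[RHS]conj_Creal// rmorphD.
have {}h2 : - 'i%R * (Num.conj be' - Num.conj be) = 'i%R * (be' - be).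
  by rewrite -[RHS]conj_Creal// rmorphM/= conjCi rmorphB.
have {}h2 : Num.conj be - Num.conj be' = be' - be.
  apply: (mulfI (neq0Ci C)); by rewrite -h2 mulNr -mulrN opprB.
have : 2 * be' = 2 * Num.conj be.
  rewrite !mulr_natl !mulr2n.
  have e : be' = Num.conj be - Num.conj be' + be by rewrite h2 subrK.
  by rewrite {1}e -addrA -h1 addrCA subrK.
move=> /mulfI; apply; by rewrite pnatr_eq0.
Qed.

Lemma tau_CS : `|tau (S * T)| ^+ 2 <= tau (S * S') * tau (T' * T).
Proof.
have al0 : 0 <= al by apply/tau_ge0/adj_pos.
have ga0 : 0 <= ga by apply/tau_ge0/adj_pos/adj_sym.
rewrite -/al -/ga -/be.
have b0 : 0 <= `|be| ^+ 2 by rewrite exprn_ge0.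
have [a ea] := complex_realP _ (ger0_real al0).
have [g eg] := complex_realP _ (ger0_real ga0).
have [b eb] := complex_realP _ (ger0_real b0).
have ebb : be * be' = b%:C by rewrite -eb normCK -tau_adj2.
move: al0 ga0 b0; rewrite ea eg eb !ler0c => a0 g0 b0.
rewrite -rmorphM lecR; apply: CS_aux => // t; rewrite -ler0c.
have ct : Num.conj t%:C = t%:C by rewrite conj_Creal// complex_real.
(* This k makes both cross terms equal to - t |be|^2, which leaves a real quadratic in t. *)
have := quad (- t%:C * be); rewrite rmorphM rmorphN /= ct -tau_adj2 -/be' ea eg.
have -> : a%:C + - t%:C * be' * be + - t%:C * be * be' +
    - t%:C * be * (- t%:C * be') * g%:C =
    a%:C - 2 * t%:C * (be * be') + t%:C ^+ 2 * (be * be') * g%:C by ring.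
by rewrite ebb -!rmorphXn -!(rmorph_nat (real_complex R)) -!rmorphM -rmorphB -rmorphD.
Qed.
End CS.

(* [c] bounds the square of the operator norm of [T]. *)
Definition opb T (c : R) := 0 <= c /\ forall x, ip (T x) (T x) <= c%:C * ip x x.

Lemma ex_opb T : exists c : R, opb T c.
Proof.
have [lT cT] := usa_bounded (vn_usa W) (vnopP T).
have := (linear_bounded_continuous T).2 cT.
move=> /linear_boundedP/pinfty_ex_gt0 [r r0 Tr]; exists (complex.Re (r ^+ 2)).
have r2 : 0 <= r ^+ 2 by rewrite exprn_ge0// ltW.
split; first by rewrite -ler0c RRe_real// ger0_real.
move=> x; rewrite RRe_real ?ger0_real// -!wp_norm -exprMn.
have rx : 0 <= r * `|x| by rewrite mulr_ge0// ltW.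
apply: lerXn2r; rewrite ?nnegrE//.
exact: Tr.
Qed.

Lemma opb1 : opb 1 1.
Proof. by split=> // x; rewrite mul1r. Qed.
Lemma opb_le T c d : c <= d -> opb T c -> opb T d.
Proof.
move=> cd [c0 h]; split; first exact: le_trans cd.
by move=> x; apply: (le_trans (h x)); rewrite ler_wpM2r ?ip_ge0// lecR.
Qed.
Lemma opbM S T c d : opb S c -> opb T d -> opb (S * T) (c * d).
Proof.
move=> [c0 Sc] [d0 Td]; split; first exact: mulr_ge0.
move=> x; rewrite vnopME (le_trans (Sc _))// rmorphM -mulrA ler_wpM2l ?ler0c//.
Qed.
Lemma opbX T c n : opb T c -> opb (T ^+ n) (c ^+ n).
Proof.
move=> Tc; elim: n => [|n ih]; first by rewrite !expr0; exact: opb1.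
by rewrite !exprS; exact: opbM.
Qed.
(** As [opb] measures squares, the parallelogram law replaces the triangle inequality and avoids
    square roots, at the price of a factor 2. *)
Lemma opbD S T c d : opb S c -> opb T d -> opb (S + T) (2 * c + 2 * d).
Proof.
move=> [c0 Sc] [d0 Td]; split; first by rewrite addr_ge0// mulr_ge0.
move=> x; rewrite vnopDE.
apply: (@le_trans _ _ (2 * ip (S x) (S x) + 2 * ip (T x) (T x))).
  rewrite -subr_ge0.
  have := ip_ge0 (S x - T x).
  by rewrite !ipBl !ipBr !ipDl !ipDr; congr (_ <= _); ring.
have -> : (2 * c + 2 * d)%:C = 2 * c%:C + 2 * d%:C.
  by rewrite rmorphD/= !(rmorphM (real_complex R)) /= !(rmorph_nat (real_complex R)).
rewrite [leRHS]mulrDl; apply: lerD; rewrite -[leRHS]mulrA; apply: ler_wpM2l => //.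
Qed.
Lemma opbZ (k : C) d T c : `|k| ^+ 2 = d%:C -> opb T c -> opb (k *: T) (d * c).
Proof.
move=> kd [c0 Tc]; split; first by rewrite mulr_ge0// -ler0c -kd exprn_ge0.
move=> x; rewrite vnopZE ipZl ipZr mulrA -normCK kd [(d * c)%:C]rmorphM /=.
by rewrite -[leRHS]mulrA; apply: ler_wpM2l => //; rewrite -kd exprn_ge0.
Qed.

(** Cauchy-Schwarz against 1 bounds the left side by tau (T' T), and T' T <= c as operators. *)
Lemma tau_bound T c : opb T c -> `|tau T| ^+ 2 <= c%:C.
Proof.
move=> [c0 Tc]; have [T' aT] := ex_adj T.
have := tau_CS adj1 aT; rewrite !mul1r tau1 mul1r => /le_trans; apply.
rewrite -subr_ge0.
have -> : c%:C - tau (T' * T) = tau (c%:C *: 1 - T' * T).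
  by rewrite linearB linearZ /= tau1 mulr1.
apply: tau_ge0; apply/posE => x.
rewrite vnopDE vnopNE vnopZE vnop1E vnopME ipBl ipZl subr_ge0.
by rewrite (adj_sym aT); exact: Tc.
Qed.
End Bounds.

(** * Freeness of norm closures *)

Section Freeness.
Local Open Scope complex_scope.
Variables (R : realType) (W : tracial_space R).
Local Notation H := (wp_space W).
Local Notation C := (R[i]).
Local Notation ip := (wp_dotp W).
Implicit Types (a S T : vnop W).

Definition starg a : set (H -> H) := star_alg_gen ip a.

Lemma sg_self a : starg a a.
Proof. by move=> A [_]; apply. Qed.
Lemma sg_one a : starg a (1 : vnop W).
Proof. by move=> A [uA _]; exact: (usa_one uA). Qed.
Lemma sg_lin a (c : C) S T : starg a S -> starg a T -> starg a (c *: S + T).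
Proof.
move=> aS aT A uA; apply: (usa_lin (proj1 uA)); [exact: aS|exact: aT].
Qed.
Lemma sg_mul a S T : starg a S -> starg a T -> starg a (S * T).
Proof.
move=> aS aT A uA; apply: (usa_comp (proj1 uA)); [exact: aS|exact: aT].
Qed.

(* The norm closure of [starg a]; it contains the resolvents of [a], which are
   not polynomials in [a]. *)
Definition cstar a T := forall e : R, 0 < e ->
  exists2 P : vnop W, starg a P & opb (T - P) e.

Lemma opb0 (e : R) : 0 <= e -> opb (0 : vnop W) e.
Proof.
move=> e0; split=> // x; rewrite vnop0E.
have -> : ip 0 0 = 0 by exact: linear0l.
by rewrite mulr_ge0 ?ip_ge0// ler0c.
Qed.

Lemma starg_cstar a T : starg a T -> cstar a T.
Proof. by move=> aT e e0; exists T => //; rewrite subrr; exact/opb0/ltW. Qed.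

Lemma cstar_lin a (c : C) S T : cstar a S -> cstar a T -> cstar a (c *: S + T).
Proof.
move=> aS aT e e0.
have [d cd] := complex_realP _ (ger0_real (exprn_ge0 2 (normr_ge0 c))).
have d0 : 0 <= d by rewrite -ler0c -cd exprn_ge0.
(* [opbD] doubles both errors, so each may be e / 4 after scaling by d = |c|^2; adding 1 keeps the
   denominator positive. *)
have [|P aP SP] := aS (e / (4 * (d + 1))).
  by rewrite divr_gt0// mulr_gt0// ltr_wpDl.
have [|Q aQ TQ] := aT (e / 4); first by rewrite divr_gt0.
exists (c *: P + Q); first exact: sg_lin.
have -> : c *: S + T - (c *: P + Q) = c *: (S - P) + (T - Q).
  by rewrite scalerBr opprD addrACA.
apply: opb_le (opbD (opbZ cd SP) TQ).
have -> : 2 * (d * (e / (4 * (d + 1)))) + 2 * (e / 4) = e - e / (2 * (d + 1)).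
  by field; rewrite gt_eqF// ltr_wpDl.
by rewrite gerBl divr_ge0 ?ltW// mulr_gt0// ltr_wpDl.
Qed.

Lemma cstar_mul a S T : cstar a S -> cstar a T -> cstar a (S * T).
Proof.
move=> aS aT e e0.
have [cS [cS0 bS]] := ex_opb S; have [cT [cT0 bT]] := ex_opb T.
(* The cap 1 bounds Q by 2 cT + 2 whatever Q is chosen, which fixes the accuracy required of P; the
   second entry gives cS f <= e / 4. *)
pose f := Num.min 1 (e / (4 * (cS + 1))).
have f0 : 0 < f by rewrite lt_min ltr01 divr_gt0// mulr_gt0// ltr_wpDl.
have [|P aP SP] := aS (e / (4 * (2 * cT + 2))).
  by rewrite divr_gt0// mulr_gt0// ltr_wpDl// mulr_ge0.
have [Q aQ TQ] := aT _ f0.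
exists (P * Q); first exact: sg_mul.
have -> : S * T - P * Q = S * (T - Q) + (S - P) * Q.
  by rewrite mulrBr mulrBl addrA subrK.
have bQ : opb Q (2 * cT + 2).
  have -> : Q = T + (-1) *: (T - Q) by rewrite scaleN1r opprB addrC subrK.
  have n1 : `|(-1 : C)| ^+ 2 = 1%:C by rewrite normrN1 expr1n.
  apply: opb_le (opbD (conj cT0 bT) (opbZ n1 TQ)).
  by rewrite lerD2l mul1r ler_piMr// ge_min lexx.
apply: opb_le (opbD (opbM (conj cS0 bS) TQ) (opbM SP bQ)).
have fe : f <= e / (4 * (cS + 1)) by rewrite ge_min lexx orbT.
have h1 : cS * f <= e / 4.
  apply: (le_trans (ler_wpM2l cS0 fe)).
  have -> : cS * (e / (4 * (cS + 1))) = e / 4 - e / (4 * (cS + 1)).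
    by field; rewrite gt_eqF// ltr_wpDl.
  by rewrite gerBl divr_ge0 ?ltW// mulr_gt0// ltr_wpDl.
have -> : e / (4 * (2 * cT + 2)) * (2 * cT + 2) = e / 4.
  by field; rewrite gt_eqF//; lra.
by lra.
Qed.

Variables (a b : vnop W).
Hypothesis fab : free_elements ip (@wp_tr R W) a b.
Local Notation gen i := (if i then a else b).

Definition letter i T := cstar (gen i) T /\ tau T = 0.

Definition alternating (l : seq (bool * vnop W)) :=
  sorted (fun i j : bool => i != j) [seq x.1 | x <- l].

Lemma prodE (d : bool * vnop W) l :
  (\prod_(x <- l) x.2 : vnop W) =
  \big[(fun f g : H -> H => f \o g)/idfun]_(i < size l) (nth d l i).2 :> (H -> H).
Proof.
elim: l => [|x l ih]; first by rewrite big_nil big_ord0.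
rewrite big_cons big_ord_recl /=.
by rewrite -ih.
Qed.

Lemma free_alg l : l != [::] -> alternating l ->
  (forall x, x \in l -> starg (gen x.1) x.2 /\ tau x.2 = 0) ->
  tau (\prod_(x <- l) x.2) = 0.
Proof.
move=> l0 al lP; pose d : bool * vnop W := (true, 0).
have sl : (0 < size l)%N by case: l l0 {al lP}.
rewrite /tau (prodE d) -[size l]prednK//.
apply: (fab (k := nth true [seq x.1 | x <- l]) (T := fun i => (nth d l i).2)).
  move=> i il; apply/eqP; have /sortedP := al => /(_ true); apply.
  by rewrite size_map -(prednK sl) ltnS.
move=> i il; have il' : (i < size l)%N by rewrite -(prednK sl) ltnS.
have := lP _ (mem_nth d il'); rewrite (nth_map d)//; by case: (nth d l i).1.
Qed.

Lemma norm_small (x : C) (c : R) : 0 <= c ->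
  (forall e : R, 0 < e -> `|x| ^+ 2 <= (c * e)%:C) -> x = 0.
Proof.
move=> c0; have x2 : 0 <= `|x| ^+ 2 by rewrite exprn_ge0.
have [y ey] := complex_realP _ (ger0_real x2); rewrite ey => h.
apply/eqP; rewrite -normr_eq0 -sqrf_eq0 ey.
suff -> : y = 0 by [].
have [//|y0] := eqVneq y 0.
have yp : 0 < y by rewrite lt0r y0 -ler0c -ey.
(* For this e the bound c e lies below y / 2, contradicting y > 0. *)
have := h (y / (2 * (c + 1))); rewrite lecR divr_gt0 ?mulr_gt0// ?ltr_wpDl//.
move=> /(_ isT).
have -> : c * (y / (2 * (c + 1))) = y / 2 - y / (2 * (c + 1)).
  by field; rewrite gt_eqF// ltr_wpDl.
have : 0 < y / (2 * (c + 1)) by rewrite divr_gt0 ?mulr_gt0// ?ltr_wpDl.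
by lra.
Qed.

(* The letters of [l1] are replaced by centered elements of the generated
   algebras one at a time, starting from the right. *)
Lemma free_cstar l1 l2 : l1 ++ l2 != [::] -> alternating (l1 ++ l2) ->
  (forall x, x \in l1 -> letter x.1 x.2) ->
  (forall x, x \in l2 -> starg (gen x.1) x.2 /\ tau x.2 = 0) ->
  tau (\prod_(x <- l1 ++ l2) x.2) = 0.
Proof.
elim/last_ind: l1 l2 => [|l1 [i T] ih] l2; first by move=> *; exact: free_alg.
move=> _; rewrite cat_rcons => al l1P l2P.
have [aT T0] : letter i T by apply: (l1P (i, T)); rewrite mem_rcons inE eqxx.
have altP P : alternating (l1 ++ (i, P) :: l2) by move: al; rewrite /alternating !map_cat.
pose L : vnop W := \prod_(x <- l1) x.2; pose U : vnop W := \prod_(x <- l2) x.2.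
have prodP P : \prod_(x <- l1 ++ (i, P) :: l2) x.2 = L * P * U :> vnop W.
  by rewrite big_cat big_cons /= mulrA.
have [cL bL] := ex_opb L; have [cU bU] := ex_opb U.
have [cL0 _] := bL; have [cU0 _] := bU.
apply: (@norm_small _ (4 * cL * cU)); first by rewrite !mulr_ge0.
move=> e e0; have [P aP TP] := aT e e0.
(* Centering stays in the generated algebra, and |tau P|^2 = |tau (T - P)|^2 <= e, so the error
   grows only to 4 e. The word with P' has trace 0 by induction, which leaves the word with T - P'
   to estimate. *)
pose P' := P - tau P *: 1.
have aP' : starg (gen i) P'.
  rewrite /P' -scaleNr addrC; apply: sg_lin => //; exact: sg_one.
have tP' : tau P' = 0.
  by rewrite /P' linearB linearZ /= tau1 mulr1 subrr.
have := ih ((i, P') :: l2) _ (altP P') _ _.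
rewrite prodP => tLPU.
have -> : tau (\prod_(x <- l1 ++ (i, T) :: l2) x.2) = tau (L * (T - P') * U).
  rewrite prodP mulrBr mulrBl linearB /= tLPU ?subr0//.
  - by case: (l1).
  - by move=> x xl1; apply: l1P; rewrite mem_rcons inE xl1 orbT.
  - by move=> x; rewrite inE => /orP[/eqP -> //|]; exact: l2P.
have TP' : opb (T - P') (4 * e).
  have -> : T - P' = (T - P) + tau P *: 1 by rewrite /P' opprB addrA addrAC.
  have [d ed] := complex_realP _ (ger0_real (exprn_ge0 2 (normr_ge0 (tau P)))).
  apply: opb_le (opbD TP (opbZ ed (opb1 W))).
  have : `|tau (T - P)| ^+ 2 <= e%:C by exact: tau_bound.
  by rewrite linearB /= T0 sub0r normrN ed lecR mulr1; lra.
have := tau_bound (opbM (opbM bL TP') bU).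
by congr (_ <= _%:C); ring.
Qed.

Lemma free_letters l : l != [::] -> alternating l ->
  (forall x, x \in l -> letter x.1 x.2) -> tau (\prod_(x <- l) x.2) = 0.
Proof.
by move=> l0 al lP; rewrite -[l]cats0; apply: free_cstar => //; rewrite cats0.
Qed.

(* [altw i j S]: [S] is an alternating product of letters, the first one of
   type [i] and the last one of type [j]. *)
Inductive altw : bool -> bool -> vnop W -> Prop :=
| altw1 i T : letter i T -> altw i i T
| altwM i j l S T : altw i j S -> altw (~~ j) l T -> altw i l (S * T).

Lemma altw_word i j S : altw i j S -> exists l,
  [/\ l != [::], alternating l, (forall x, x \in l -> letter x.1 x.2),
   head i [seq x.1 | x <- l] = i /\ last j [seq x.1 | x <- l] = j &
   S = \prod_(x <- l) x.2].
Proof.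
elim=> {i j S} [i T iT|i j l S T _ [s [s0 als sP [hs ls] ->]] _ [t [t0 alt tP [ht lt] ->]]].
  exists [:: (i, T)]; split=> //; first by move=> x; rewrite inE => /eqP ->.
  by rewrite big_seq1.
exists (s ++ t); split.
- by case: (s) s0.
- case: s s0 als hs ls {sP} => // x s _; case: t t0 alt ht lt {tP} => // y t _.
  rewrite /alternating /= => ty hy _ xs _ ls.
  by rewrite map_cat cat_path /= xs ls ty hy andbT; case: (j).
- by move=> x; rewrite mem_cat => /orP[]; [exact: sP|exact: tP].
- case: s s0 {als sP} hs ls => // x s _ /= hs ls; split=> //.
  rewrite map_cat last_cat.
  by case: t t0 {alt tP ht} lt.
- by rewrite big_cat.
Qed.

Lemma altw_tau0 i j S : altw i j S -> tau S = 0.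
Proof. by case/altw_word => l [l0 al lP _ ->]; exact: free_letters. Qed.
End Freeness.

(** * Resolvents *)

Section Neumann.
Local Open Scope complex_scope.
Variables (R : realType) (W : tracial_space R).
Local Notation H := (wp_space W).
Local Notation C := (R[i]).
Local Notation ip := (wp_dotp W).
Variables (Y : vnop W) (q : R).
Hypotheses (q0 : 0 <= q) (q1 : q < 1) (Yq : opb Y (q ^+ 2)).

Let Ynorm x : `|Y x| <= q%:C * `|x|.
Proof.
have qx : 0 <= q%:C * `|x| by rewrite mulr_ge0// ler0c.
have := Yq.2 x; rewrite -!wp_norm (rmorphXn (real_complex R)) -exprMn.
by rewrite ler_pXn2r ?nnegrE.
Qed.

Let Yiter x n : `|(Y ^+ n) x| <= (q ^+ n)%:C * `|x|.
Proof.
elim: n => [|n ih]; first by rewrite !expr0 mul1r.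
rewrite !exprS vnopME (le_trans (Ynorm _))// rmorphM -mulrA ler_wpM2l// ler0c//.
Qed.

Let sum_bound x m n : `|\sum_(m <= k < n) (Y ^+ k) x| <= (q ^+ m / (1 - q))%:C * `|x|.
Proof.
have q1' : 0 < 1 - q by rewrite subr_gt0.
have [nm|/ltnW mn] := leqP n m.
  by rewrite big_geq// normr0 mulr_ge0// ler0c divr_ge0// ?exprn_ge0// ltW.
(* The induction on n needs the exact geometric sum; the bound without n is weaker. *)
apply: (@le_trans _ _ (((q ^+ m - q ^+ n) / (1 - q))%:C * `|x|)); last first.
  apply: ler_wpM2r => //; rewrite lecR; apply: ler_wpM2r.
    by rewrite invr_ge0 ltW.
  by rewrite gerBl exprn_ge0.
elim: n mn => [|n ih]; first by rewrite leqn0 => /eqP ->; rewrite big_geq// normr0 subrr mul0r mul0r.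
rewrite leq_eqVlt => /orP[/eqP ->|]; first by rewrite big_geq// normr0 subrr mul0r mul0r.
rewrite ltnS => mn; rewrite big_nat_recr//= (le_trans (ler_normD _ _))//.
apply: (le_trans (lerD (ih mn) (Yiter x n))).
rewrite -mulrDl -rmorphD /= ler_wpM2r// lecR.
rewrite le_eqVlt; apply/orP; left; apply/eqP.
by rewrite exprS; field; rewrite gt_eqF.
Qed.

Lemma neumann_fix_uniq x e e' : e = x + Y e -> e' = x + Y e' -> e = e'.
Proof.
move=> ee ee'; apply/subr0_eq/eqP; rewrite -normr_eq0.
have d : e - e' = Y (e - e').
  by rewrite [Y _](linearB (Y : {linear H -> H})) {1}ee {1}ee' opprD addrACA subrr add0r.
have := Ynorm (e - e'); rewrite -d => h.
rewrite eq_le normr_ge0 andbT.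
have : (1 - q)%:C * `|e - e'| <= 0 by rewrite rmorphB mulrBl mul1r subr_le0.
by rewrite pmulr_rle0// ltcR subr_gt0.
Qed.

(** The solution is the sum of the vectors Y^k x. Convergence is taken in the complete space H,
    vector by vector, rather than in a norm on operators. *)
Lemma neumann_fix_ex x : exists e, e = x + Y e.
Proof.
pose u k := (Y ^+ k) x.
have cvu : cvgn (series u).
  apply/cauchy_cvgP; apply/cauchy_seriesP => e e0.
  have [e' ee'] := complex_realP _ (gtr0_real e0).
  move: e0; rewrite ee' (ltcR 0) => e0.
  have [y ey] := complex_realP _ (ger0_real (normr_ge0 x)).
  have y0 : 0 <= y by rewrite -ler0c -ey.
  have q1' : 0 < 1 - q by rewrite subr_gt0.
  have dp : 0 < e' * (1 - q) / (y + 1) by rewrite divr_gt0 ?mulr_gt0// ltr_wpDl.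
  have qc : (q ^+ n @[n --> \oo] --> (0 : R))%classic.
    by apply: cvg_expr; rewrite ger0_norm.
  have /cvgrPdist_lt/(_ _ dp) [N _ hN] := qc.
  exists ([set n | (N <= n)%N], setT) => /=; first by split; [exists N|exact: filterT].
  move=> [m n] [/= Nm _]; apply: (le_lt_trans (sum_bound x m n)).
  rewrite ey -rmorphM ltcR.
  have := hN _ Nm; rewrite /= sub0r normrN ger0_norm ?exprn_ge0//.
  rewrite ltr_pdivlMr ?ltr_wpDl// => h.
  rewrite mulrAC ltr_pdivrMr//; apply: le_lt_trans h.
  by rewrite ler_wpM2l ?exprn_ge0// lerDl.
have [l ul] := (cvg_ex _).1 cvu; exists l.
have cY : continuous Y := (usa_bounded (vn_usa W) (vnopP Y)).2.
have h1 : (x + Y (series u n)) @[n --> \oo] --> x + Y l.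
  by apply: cvgD; [exact: cvg_cst|exact: (cvg_comp _ _ ul (cY l))].
have h2 : (x + Y (series u n)) @[n --> \oo] --> l.
  have -> : (fun n => x + Y (series u n)) = (fun n => series u n.+1).
    apply/funext => n; rewrite /series /= big_nat_recl//= /u expr0 vnop1E; congr (_ + _).
    rewrite [LHS](linear_sum (Y : {linear H -> H})); apply: eq_bigr => k _.
    by rewrite exprS.
  by rewrite (cvg_shiftS (series u)).
exact: (cvg_unique _ h2 h1).
Qed.

(** The inverse of 1 - Y, pointwise; linearity, membership in the algebra and commutation with Y all
    follow from uniqueness of the fixed point. *)
Let E x := projT1 (cid (neumann_fix_ex x)).
Let EP x : E x = x + Y (E x). Proof. by rewrite /E; case: cid. Qed.
Let Euniq x e : e = x + Y e -> E x = e.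
Proof. by move=> h; apply: neumann_fix_uniq (EP x) h. Qed.

Let Elin : linear E.
Proof.
move=> c x y; apply: Euniq; rewrite vnopD vnopZ.
by rewrite {1}[E x]EP {1}[E y]EP scalerDr addrACA.
Qed.

Let Enorm x : `|E x| <= ((1 - q)^-1)%:C * `|x|.
Proof.
have q1' : 0 < 1 - q by rewrite subr_gt0.
have : `|E x| <= `|x| + q%:C * `|E x|.
  by rewrite {1}EP (le_trans (ler_normD _ _))// lerD2l.
rewrite -lerBlDr => h.
rewrite fmorphV -ler_pdivrMl ?invr_gt0 ?ltcR// invrK.
by rewrite rmorphB mulrBl mul1r.
Qed.

Let Econt : continuous E.
Proof.
pose E' : {linear H -> H} := HB.pack E (GRing.isLinear.Build C H H *:%R E Elin).
apply: (@bounded_linear_continuous _ _ _ E').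
apply/linear_boundedP; exists ((1 - q)^-1)%:C; split; first by rewrite complex_real.
move=> r qr x; apply: (le_trans (Enorm x)); rewrite ler_wpM2r//; exact: ltW.
Qed.

Lemma bicommutant_M T : bounded_op T ->
  (forall S : H -> H, bounded_op S -> (forall U, wp_alg U -> S \o U = U \o S) -> T \o S = S \o T) ->
  @wp_alg R W T.
Proof.
move=> bT h; have [_ <-] := wp_vN W; split=> // S [bS SU]; exact: h.
Qed.

(** An operator S in the commutant commutes with Y, so S (E x) solves the equation that defines E (S
    x); the bicommutant property concludes. *)
Let EM : wp_alg E.
Proof.
apply: bicommutant_M; first by split.
move=> S [lS cS] SU; apply/funext => x /=; apply: Euniq.
have <- : S (Y (E x)) = Y (S (E x)) by have /(congr1 (fun f => f (E x))) := SU _ (vnopP Y).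
rewrite {1}EP.
by have := lS 1 x (Y (E x)); rewrite !scale1r.
Qed.

Lemma neumann : exists V : vnop W, exists2 c : R, 0 <= c &
  [/\ V * (1 - Y) = 1, (1 - Y) * V = 1 &
      forall n, opb (V - \sum_(j < n) Y ^+ j) ((q ^+ n) ^+ 2 * c)].
Proof.
pose V : vnop W := VNop EM.
have VE : V = 1 + Y * V by apply: vnop_eq => x; exact: EP.
have YV : Y * V = V * Y.
  apply: vnop_eq => x; rewrite !vnopME; apply/esym; apply: Euniq.
  by rewrite -vnopD -EP.
have VY : (1 - Y) * V = 1 by rewrite mulrBl mul1r {1}VE addrK.
have [c bV] := ex_opb V; have [c0 _] := bV.
exists V, c => //.
have VY1 : V * (1 - Y) = 1 by rewrite mulrBr mulr1 -YV {1}VE addrK.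
split=> // n; have -> : V - \sum_(j < n) Y ^+ j = V * Y ^+ n.
  have h : V * (1 - Y ^+ n) = \sum_(j < n) Y ^+ j.
    by rewrite -opprB subrX1 -mulNr opprB mulrA VY1 mul1r.
  by rewrite -h mulrBr mulr1 opprB addrC subrK.
by rewrite mulrC; apply: opbM => //; rewrite exprAC; exact: opbX.
Qed.
End Neumann.

Section Resolvent.
Local Open Scope complex_scope.
Variables (R : realType) (W : tracial_space R).
Local Notation H := (wp_space W).
Local Notation C := (R[i]).
Local Notation ip := (wp_dotp W).
Implicit Types (S T : vnop W) (p : {poly R}).

(** The coefficient form matches [int_poly] when moments are compared; [pevE] supplies the
    multiplicative form. *)
Definition pev T p : vnop W := \sum_(i < size p) (p`_i)%:C *: T ^+ i.

Lemma horner_algZ T (c : C) (r : {poly C}) :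
  horner_alg T (c *: r) = c *: horner_alg T r.
Proof. by rewrite linearZ /= mulr_algl. Qed.

Lemma pevE T p : pev T p = horner_alg T (map_poly (real_complex R) p).
Proof.
have -> : map_poly (real_complex R) p = \sum_(i < size p) (p`_i)%:C *: 'X^i.
  rewrite -{1}[p]coefK poly_def rmorph_sum; apply: eq_bigr => i _.
  by rewrite -mul_polyC rmorphM /= map_polyC map_polyXn mul_polyC.
rewrite rmorph_sum; apply: eq_bigr => i _.
by rewrite /= horner_algZ rmorphXn /= horner_algX.
Qed.

Lemma sg_sum (T : vnop W) (I : Type) (r : seq I) (F : I -> vnop W) :
  (forall i, starg T (F i)) -> starg T (\sum_(i <- r) F i : vnop W).
Proof.
move=> h; elim: r => [|i r ih].
  rewrite big_nil.
  have := sg_lin (-1) (@sg_one R W T) (@sg_one R W T).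
  by have -> : (-1) *: 1 + 1 = 0 :> vnop W by rewrite scaleN1r addNr.
by rewrite big_cons; have := sg_lin 1 (h i) ih; rewrite scale1r.
Qed.
Lemma sg_exp (T : vnop W) S n : starg T S -> starg T (S ^+ n : vnop W).
Proof.
move=> TS; elim: n => [|n ih]; first exact: sg_one.
by rewrite exprS; exact: sg_mul.
Qed.
Lemma sg_pev T p : starg T (pev T p).
Proof.
apply: sg_sum => i.
have := sg_lin (p`_i)%:C (sg_exp i (@sg_self R W T)) (@sg_sum T nat [::] (fun=> T) (fun=> @sg_self R W T)).
by rewrite big_nil addr0.
Qed.

(** Since u T need not be small, the inverse of Z = 1 - u T is expanded as th times the sum of the
    powers of 1 - th Z, a contraction for small th because Z >= 1. The extra condition on th makes
    the same polynomials converge on [0, L]. *)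
Lemma resolvent T (u L : R) : pos T -> u <= 0 -> 0 <= L ->
  exists (A : vnop W) (th q c : R) , [/\ 0 < th < 1, th * (1 - u * L) <= 1,
   0 <= q < 1 /\ 0 <= c,
   A * (1 - u%:C *: T) = 1 /\ (1 - u%:C *: T) * A = 1 &
   forall n, opb (A - pev T (th *: \sum_(j < n) ((1 - th)%:P + (th * u) *: 'X) ^+ j)) (q ^+ n * c)].
Proof.
move=> pT u0 L0; pose Z : vnop W := 1 - u%:C *: T.
have [cZ bZ] := ex_opb Z.
(* th = 1 / B must satisfy |Z|^2 <= 1 / th, th <= 1 / 2 and th (1 - u L) <= 1. *)
pose B := Num.max cZ (2 + - u * L).
have B2 : 2 <= B by rewrite le_max lerDl mulr_ge0 ?oppr_ge0// orbT.
have BL : 2 - u * L <= B by rewrite le_max mulNr lexx orbT.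
have bB : opb Z B by apply: opb_le bZ; rewrite le_max lexx.
have B0 : 0 < B by lra.
pose th := B^-1.
have th0 : 0 < th by rewrite invr_gt0.
have thB : th * B = 1 by rewrite mulVf// gt_eqF.
have th12 : th <= 2^-1 by rewrite lef_pV2 ?posrE.
pose Y : vnop W := 1 - th%:C *: Z.
pose q := 1 - th / 2.
have q0 : 0 <= q by rewrite /q; lra.
have q1 : q < 1 by rewrite /q; lra.
(* [1 <= Z] and [|Z|^2 <= 1 / th] give [|1 - th Z|^2 <= 1 - 2 th + th <= q^2]. *)
have Yq : opb Y (q ^+ 2).
  suff : opb Y (1 - th).
    by apply: opb_le; rewrite /q -subr_ge0; have := sqr_ge0 (th / 2); rewrite !expr2; lra.
  split; first by lra.
  move=> x; have xr : ip x x \is Num.real by rewrite ger0_real// ip_ge0.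
  have Zx : ip x x <= ip (Z x) x.
    rewrite /Z vnopDE vnopNE vnopZE vnop1E ipBl ipZl -subr_ge0 addrAC subrr add0r -mulNr -rmorphN.
    by rewrite mulr_ge0 ?ler0c ?oppr_ge0//; exact: (posE T).1.
  have Zr : ip (Z x) x \is Num.real by rewrite ger0_real// (le_trans (ip_ge0 x)).
  have Zc : ip x (Z x) = ip (Z x) x by rewrite ipCn conj_Creal.
  have ct : Num.conj th%:C = th%:C by rewrite conj_Creal// complex_real.
  rewrite /Y vnopDE vnopNE vnopZE vnop1E ipBl !ipBr !ipZl !ipZr Zc ct.
  have h1 : th%:C * ip x x <= th%:C * ip (Z x) x by rewrite ler_wpM2l// ler0c ltW.
  have h2 : th%:C * (th%:C * ip (Z x) (Z x)) <= th%:C * ip x x.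
    rewrite ler_wpM2l ?ler0c ?(ltW th0)//.
    have := bB.2 x => /(ler_wpM2l (_ : 0 <= th%:C)); rewrite ler0c ltW// => /(_ isT).
    by rewrite mulrA -rmorphM thB mul1r.
  rewrite rmorphB mulrBl mul1r -subr_ge0.
  have := addr_ge0 (addr_ge0 (_ : 0 <= th%:C * ip (Z x) x - th%:C * ip x x) (_ : 0 <= th%:C * ip (Z x) x - th%:C * ip x x)) (_ : 0 <= th%:C * ip x x - th%:C * (th%:C * ip (Z x) (Z x))).
  rewrite !subr_ge0 => /(_ h1 h1 h2); rewrite -subr_ge0; congr (_ <= _); ring.
have [V [c c0 [V1 V2 Vn]]] := neumann q0 q1 Yq.
have ZY : 1 - Y = th%:C *: Z by rewrite /Y opprB addrC subrK.
exists (th%:C *: V), th, q, (th ^+ 2 * c); split.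
- by apply/andP; split=> //; lra.
- have -> : 1 = th * B by []. 
  by rewrite ler_pM2l//; lra.
- by rewrite q0 q1 mulr_ge0// sqr_ge0.
- rewrite -/Z -scalerAl -scalerAr; split.
    by rewrite scalerAr -ZY.
  by rewrite scalerAl -ZY.
move=> n; rewrite pevE map_polyZ /= horner_algZ rmorph_sum rmorph_sum /=.
have -> : \sum_(j < n) horner_alg T (map_poly (real_complex R) (((1 - th)%:P + (th * u) *: 'X) ^+ j)) = \sum_(j < n) Y ^+ j.
  apply: eq_bigr => j _; rewrite !rmorphXn /=; congr (_ ^+ _).
  rewrite rmorphD rmorphD /= map_polyC map_polyZ /= map_polyX horner_algZ horner_algX horner_algC.
  rewrite /Y /Z scalerBr scalerA opprB addrCA addrC -rmorphM.
  by rewrite rmorphB scalerBl scale1r.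
rewrite -scalerBr.
have ct : `|th%:C| ^+ 2 = (th ^+ 2)%:C by rewrite ger0_norm ?rmorphXn// ler0c ltW.
apply: opb_le (opbZ ct (Vn n)).
rewrite mulrCA; apply: ler_wpM2r; first by rewrite mulr_ge0// sqr_ge0.
by rewrite expr2 ler_piMl ?exprn_ge0// exprn_ile1// ltW.
Qed.

Lemma vanishing (q c e : R) : 0 <= q < 1 -> 0 <= c -> 0 < e -> exists n, q ^+ n * c <= e.
Proof.
move=> /andP[q0 q1] c0 e0.
have c1 : 0 < c + 1 by rewrite ltr_wpDl.
have qc : q ^+ n @[n --> \oo] --> (0 : R) by apply: cvg_expr; rewrite ger0_norm.
have /cvgrPdist_lt/(_ _ (divr_gt0 e0 c1)) [N _ hN] := qc.
exists N; have := hN N (leqnn N); rewrite /= sub0r normrN ger0_norm ?exprn_ge0//.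
rewrite ltr_pdivlMr// => /ltW; apply: le_trans.
by rewrite ler_wpM2l ?exprn_ge0// lerDl.
Qed.

Lemma resolvent_adj T (u : R) A : adj T T -> A * (1 - u%:C *: T) = 1 -> (1 - u%:C *: T) * A = 1 ->
  adj A A.
Proof.
move=> aT A1 A2 x y; set Z := 1 - _ in A1 A2.
have aZ : adj Z Z.
  apply: adjB; first exact: adj1.
  by have := adjZ u%:C aT; rewrite conj_Creal// complex_real.
have xE : x = Z (A x) by rewrite -vnopME A2.
have yE : y = Z (A y) by rewrite -vnopME A2.
by rewrite {1}yE {2}xE aZ.
Qed.

Lemma sqr_normD (x y : C) : `|x + y| ^+ 2 <= 2 * `|x| ^+ 2 + 2 * `|y| ^+ 2.
Proof.
have h : `|x + y| ^+ 2 <= (`|x| + `|y|) ^+ 2.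
  by rewrite lerXn2r ?nnegrE ?addr_ge0// ler_normD.
apply: (le_trans h); rewrite -subr_ge0.
have -> : 2 * `|x| ^+ 2 + 2 * `|y| ^+ 2 - (`|x| + `|y|) ^+ 2 = (`|x| - `|y|) ^+ 2 by ring.
by apply: real_exprn_even_ge0 => //; rewrite realB ?normr_real.
Qed.

Lemma tau_pev (mu : probability (measurableTypeR R) R) T l h p :
  supp mu l h -> (forall n, tau (T ^+ n) = (\int[mu]_x (x ^+ n))%:C) ->
  tau (pev T p) = (\int[mu]_x p.[x])%:C.
Proof.
move=> slh mT; rewrite (int_poly slh) /pev linear_sum rmorph_sum; apply: eq_bigr => i _.
by rewrite linearZ /= mT rmorphM.
Qed.

Section Trace.
Variables (mu : probability (measurableTypeR R) R) (T : vnop W) (L : R).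
Hypotheses (sL : supp mu 0 L) (pT : pos T)
  (mT : forall n, tau (T ^+ n) = (\int[mu]_x (x ^+ n))%:C).

(** Moments determine [tau] on polynomials only. The partial sums from [resolvent] approximate A in
    norm and (1 - u x)^-1 uniformly on [0, L], so trace and integral have the same limit. *)
Lemma resolvent_tau (u : R) : 0 <= L -> u <= 0 -> exists A : vnop W,
  [/\ A * (1 - u%:C *: T) = 1, (1 - u%:C *: T) * A = 1, adj A A, cstar T A &
      tau A = (1 + psi mu u)%:C].
Proof.
move=> L0 u0; have [A [th [q [c [/andP[th0 th1] thL [q01 c0] [A1 A2] An]]]]] := resolvent pT u0 L0.
exists A; split=> //.
- exact: resolvent_adj (pos_adj pT) A1 A2.
- move=> e e0; have [n qn] := vanishing q01 c0 e0.
  by exists (pev T (th *: \sum_(j < n) ((1 - th)%:P + (th * u) *: 'X) ^+ j)); [exact: sg_pev|exact: opb_le qn (An n)].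
rewrite /psi addrC subrK; set I := \int[mu]_x _.
apply/subr0_eq/(@norm_small _ _ 4) => // e e0.
have [n qn] := vanishing q01 c0 e0.
have th1' : 0 <= (1 - th) ^+ 2 < 1.
  by rewrite sqr_ge0 expr_lt1 //; lra.
have [m qm] := vanishing th1' ler01 e0; rewrite mulr1 in qm.
(* One polynomial serves both estimates: n terms are enough for the operator, m for the scalar
   function. *)
pose P : {poly R} := th *: \sum_(j < m + n) ((1 - th)%:P + (th * u) *: 'X) ^+ j.
have sum_geo x : 0 <= x <= L -> P.[x] = (1 - ((1 - th) + th * u * x) ^+ (m + n)) * (1 - u * x)^-1.
  move=> /andP[x0 xL].
  have ux : 0 < 1 - u * x by rewrite ltr_pwDl// oppr_ge0 mulr_le0_ge0.
  rewrite /P hornerZ horner_sum; set y := 1 - th + th * u * x.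
  rewrite (eq_bigr (fun j : 'I_(m + n) => y ^+ j)); last first.
    by move=> j _; rewrite horner_exp !hornerE.
  apply: (mulIf (x := 1 - u * x)); first by rewrite gt_eqF.
  rewrite divfK ?gt_eqF// -[1 - y ^+ _]opprB subrX1.
  have -> : y - 1 = - (th * (1 - u * x)) by rewrite /y; ring.
  by rewrite mulNr opprK mulrAC.
have tP : tame 0 L (fun x => P.[x]) by exact: tame_poly.
have tR := tame_resolvent L u0.
have IP : `|\int[mu]_x P.[x] - I| <= (1 - th) ^+ (m + n).
  have key x : 0 <= x <= L -> `|P.[x] - (1 - u * x)^-1| <= (1 - th) ^+ (m + n).
    move=> xL; rewrite sum_geo//; move: xL => /andP[x0 xL].
    have ux : 0 <= - (u * x) by rewrite oppr_ge0 mulr_le0_ge0.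
    have uxL : - (u * x) <= - (u * L) by rewrite lerN2 ler_wnM2l.
    have y0 : 0 <= 1 - th + th * u * x.
      have : th * (1 - u * x) <= th * (1 - u * L) by rewrite ler_pM2l//; lra.
      lra.
    have y1 : 1 - th + th * u * x <= 1 - th.
      by rewrite gerDl -mulrA mulr_ge0_le0 -?oppr_ge0// ltW.
    rewrite mulrBl mul1r addrAC subrr add0r normrN normrM normrX ger0_norm//.
    rewrite [X in _ * X]ger0_norm ?invr_ge0; last by lra.
    have : (1 - th + th * u * x) ^+ (m + n) <= (1 - th) ^+ (m + n) by rewrite lerXn2r// nnegrE; lra.
    apply: le_trans; rewrite ler_piMr ?exprn_ge0// invf_le1; lra.
  rewrite ler_norml; apply/andP; split.
    rewrite lerBrDr -[X in X + _](int_cst mu) -(intD sL (tame_cst _ _ _) tR).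
    apply: (int_le sL _ tP); first exact: tameD (tame_cst _ _ _) tR.
    by move=> x /key; rewrite ler_norml => /andP[+ _]; lra.
  rewrite lerBlDr -[X in X + _](int_cst mu) -(intD sL (tame_cst _ _ _) tR).
  apply: (int_le sL tP); first exact: tameD (tame_cst _ _ _) tR.
  by move=> x /key; rewrite ler_norml => /andP[_]; lra.
have := tau_bound (An (m + n)%N); rewrite linearB /= (tau_pev _ sL mT) -/P => AP.
pose J := \int[mu]_x P.[x]; rewrite -/J in IP AP.
have -> : tau A - I%:C = (tau A - J%:C) + (J - I)%:C by rewrite rmorphB addrA subrK.
apply: (le_trans (sqr_normD _ _)).
have -> : `|(J - I)%:C| ^+ 2 = ((J - I) ^+ 2)%:C.
  rewrite real_normK; first by rewrite rmorphXn.
  by rewrite complex_real.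
have h1 : (J - I) ^+ 2 <= e.
  rewrite -real_normK ?num_real//; apply: le_trans qm; rewrite exprAC.
  rewrite lerXn2r ?nnegrE ?exprn_ge0//; try lra.
  apply: (le_trans IP); rewrite exprD ler_piMr ?exprn_ge0 ?exprn_ile1//; lra.
have h2 : q ^+ (m + n) * c <= e.
  move: q01 => /andP[q0 q1]; apply: le_trans qn; rewrite exprD -mulrA ler_piMl ?mulr_ge0 ?exprn_ge0//.
  by rewrite exprn_ile1// ltW.
have h3 : (4 * e)%:C = 2 * e%:C + 2 * e%:C by rewrite rmorphM rmorph_nat /=; ring.
rewrite h3; apply: lerD; apply: ler_wpM2l => //; last by rewrite lecR.
by apply: (le_trans AP); rewrite lecR.
Qed.
End Trace.

End Resolvent.

(** * The free product *)

Section FreeProduct.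
Local Open Scope complex_scope.
Variables (R : realType) (W : tracial_space R).
Local Notation H := (wp_space W).
Local Notation C := (R[i]).
Local Notation ip := (wp_dotp W).
Implicit Types (S T U V : vnop W).

Lemma adj_exp S S' n : adj S S' -> adj (S ^+ n) (S' ^+ n).
Proof.
move=> a; elim: n => [|n ih]; first by rewrite !expr0; exact: adj1.
by rewrite exprS exprSr; exact: adjM.
Qed.

Lemma adjZr (k : R) T T' : adj T T' -> adj (k%:C *: T) (k%:C *: T').
Proof. by move/(adjZ k%:C); rewrite conj_Creal// complex_real. Qed.
Lemma adj_shift (k : R) T : adj T T -> adj (T - k%:C *: 1) (T - k%:C *: 1).
Proof. by move=> a; apply: adjB => //; apply/adjZr/adj1. Qed.
Lemma tauZ (c : C) T : tau (c *: T) = c * tau T. Proof. exact: linearZ. Qed.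
Lemma tauB S T : tau (S - T) = tau S - tau T. Proof. exact: linearB. Qed.
Lemma tauD S T : tau (S + T) = tau S + tau T. Proof. exact: linearD. Qed.
Lemma tau_sqr_shift (A : vnop W) (c : C) :
  tau ((A - c *: 1) * (A - c *: 1)) = tau (A * A) - 2 * c * tau A + c ^+ 2.
Proof.
have -> : (A - c *: 1) * (A - c *: 1) = A * A - c *: A - (c *: A - c *: (c *: 1)).
  by rewrite mulrBl !mulrBr -!scalerAl -!scalerAr !(mulr1, mul1r).
by rewrite !tauB !tauZ tau1; ring.
Qed.

(** A (1 - u T) A = A gives tau (A^2) = ze + u tau (A T A). By faithfulness tau (A T A) > 0, as
    otherwise T = 0 and A = 1, against ze < 1; hence the strict inequality. *)
Lemma variance_bound T A (u ze : R) : pos T -> u < 0 -> ze < 1 ->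
  A * (1 - u%:C *: T) = 1 -> (1 - u%:C *: T) * A = 1 -> adj A A -> tau A = ze%:C ->
  exists2 al : R, tau ((A - ze%:C *: 1) * (A - ze%:C *: 1)) = al%:C & 0 <= al < ze - ze ^+ 2.
Proof.
move=> pT u0 ze1 A1 A2 aA tA.
have pATA : pos (A * T * A) by exact: pos_conj.
have AAA : A = A * A - u%:C *: (A * T * A).
  rewrite -[LHS]mul1r -A1 mulrBr mulr1 mulrBl; congr (_ - _).
  by rewrite -scalerAr -scalerAl.
have t0 : tau (A * T * A) != 0.
  apply/eqP => t0; have ATA0 := tau_eq0 pATA t0.
  have T0 : T = 0.
    have : (1 - u%:C *: T) * (A * T * A) * (1 - u%:C *: T) = 0 by rewrite ATA0 mulr0 mul0r.
    by rewrite !mulrA A2 mul1r -mulrA A1 mulr1.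
  move: A1; rewrite T0 scaler0 subr0 mulr1 => A1; move: tA; rewrite A1 tau1.
  by move=> /complexI e1; move: ze1; rewrite -e1 ltxx.
have ge0 := tau_ge0 pATA.
have [g eg] := complex_realP _ (ger0_real ge0).
have g0 : 0 < g by rewrite -(ltcR 0) -eg lt0r t0.
have tAA : tau (A * A) = (ze + u * g)%:C.
  have := congr1 (@tau R W) AAA; rewrite tauB tauZ tA eg => /eqP.
  by rewrite rmorphD rmorphM /= eq_sym subr_eq => /eqP.
exists (ze + u * g - ze ^+ 2).
  by rewrite tau_sqr_shift tA tAA rmorphB rmorphXn /=; ring.
apply/andP; split; last by rewrite ltrD2r gtrDl nmulr_rlt0.
have aB := adj_shift ze aA.
have := tau_ge0 (adj_pos aB).
by rewrite tau_sqr_shift tA tAA -ler0c rmorphB rmorphXn /=; congr (_ <= _); ring.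
Qed.

Lemma shift_mul S T (c : C) :
  (S + c *: 1) * (T + c *: 1) = S * T + c *: (S + T) + (c * c) *: 1.
Proof.
rewrite -(scalerA c c) mulrDl !mulrDr -!scalerAl -!scalerAr !(mulr1, mul1r).
by rewrite scalerDr !addrA.
Qed.

Lemma shift_mul3 S M T (c : C) : (S + c *: 1) * M * (T + c *: 1) =
  S * M * T + c *: (S * M) + (c *: (M * T) + (c * c) *: M).
Proof.
rewrite -(scalerA c c) !mulrDl !mulrDr -!scalerAr -!scalerAl !(mulr1, mul1r).
by rewrite -!addrA.
Qed.

Lemma shift_cancel S T U (al be c d : C) :
  S + d *: T + al *: U - (c *: S + d *: T + be *: U) = (1 - c) *: S + (al - be) *: U.
Proof.
rewrite opprD addrACA -scalerBl; congr (_ + _).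
by rewrite opprD addrACA subrr addr0 scalerBl scale1r.
Qed.

(** The linear terms cancel since (ze / z) z = ze, the constants leave ze^2 - ze z = ze, and S T
    keeps the coefficient 1 - ze / z = - 1 / z. *)
Lemma factor_alg S T (z ze : R) : z != 0 -> ze != 0 -> ze - z = 1 ->
  (S + ze%:C *: 1) * (T + ze%:C *: 1) - (ze / z)%:C *: ((S + z%:C *: 1) * (T + z%:C *: 1)) =
  ze%:C *: (1 - ((z * ze)^-1)%:C *: (S * T)).
Proof.
move=> z0 ze0 zze; rewrite !shift_mul.
have c1 : (ze / z)%:C * z%:C = ze%:C by rewrite -rmorphM divfK.
have c2 : (ze / z)%:C * (z%:C * z%:C) = ze%:C * z%:C by rewrite mulrA c1.
rewrite [X in _ - X]scalerDr [X in _ - (X + _)]scalerDr !scalerA c1 c2 shift_cancel.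
have zz : ze%:C = 1 + z%:C by rewrite -[ze](subrK z) zze rmorphD rmorph1.
have c3 : ze%:C * ze%:C - ze%:C * z%:C = ze%:C by rewrite -mulrBr {2}zz addrK mulr1.
rewrite c3 scalerBr scalerA addrC -scaleNr; congr (_ + _ *: _).
rewrite -rmorphM -rmorphN -(rmorph1 (real_complex R)) -rmorphB; congr (_%:C).
have ez : ze = 1 + z by rewrite -zze subrK.
by rewrite ez in ze0 *; field; rewrite ?z0 ?ze0.
Qed.

Lemma fixpoint_expand S T n : T = 1 + S * T -> T = \sum_(j < n) S ^+ j + S ^+ n * T.
Proof.
move=> h; elim: n => [|n ih]; first by rewrite big_ord0 add0r expr0 mul1r.
rewrite {1}ih big_ord_recr /= -addrA; congr (_ + _).
by rewrite {1}h mulrDr mulr1 mulrA -exprSr.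
Qed.

Lemma tau_sandwich S T U V n :
  tau (U * (\sum_(j < n) S ^+ j + T) * V) = \sum_(j < n) tau (U * S ^+ j * V) + tau (U * T * V).
Proof. by rewrite mulrDr mulrDl tauD mulr_sumr mulr_suml [tau (\sum_(i < n) _)]linear_sum. Qed.

Section Core.
Variables (a b A B D : vnop W) (u v z : R).
Hypotheses (fab : free_elements ip (@wp_tr R W) a b)
  (pa : pos a) (pb : pos b) (u0 : u < 0) (v0 : v < 0) (z1 : -1 < z) (z0 : z < 0)
  (A1 : A * (1 - u%:C *: a) = 1) (A2 : (1 - u%:C *: a) * A = 1)
  (B1 : B * (1 - v%:C *: b) = 1) (B2 : (1 - v%:C *: b) * B = 1)
  (aA : adj A A) (aB : adj B B) (cA : cstar a A) (cB : cstar b B)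
  (tA : tau A = (1 + z)%:C) (tB : tau B = (1 + z)%:C).
Let w := (1 + z) / z * u * v.
Hypotheses (D1 : (1 - w%:C *: (a * b)) * D = 1).
Let ze := 1 + z.
Let p : vnop W := A - ze%:C *: 1.
Let q : vnop W := B - ze%:C *: 1.
Let k := (z * ze)^-1.
Let X : vnop W := k%:C *: (p * q).
(** The right inverse of 1 - X read off from [factor]: inverses of the three factors in reverse
    order, times ze. *)
Let F : vnop W := ze%:C *: ((1 - v%:C *: b) * D * (1 - u%:C *: a)).

Let zep : 0 < ze. Proof. by rewrite /ze -(ltrD2l (-1)) addKr addr0. Qed.
Let ze0 : ze != 0. Proof. by rewrite gt_eqF. Qed.
Let zn0 : z != 0. Proof. by rewrite lt_eqF. Qed.

Let centered T (S : vnop W) : cstar S T -> tau T = ze%:C -> cstar S (T - ze%:C *: 1) /\ tau (T - ze%:C *: 1) = 0.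
Proof.
move=> cT tT; split; last by rewrite tauB tauZ tau1 mulr1 tT subrr.
rewrite -scaleNr addrC; apply: cstar_lin => //; apply: starg_cstar; exact: sg_one.
Qed.

Let lp : letter a b true p. Proof. exact: centered. Qed.
Let lq : letter a b false q. Proof. exact: centered. Qed.
Local Notation altw := (altw a b).

Let alt_pq n : altw true false ((p * q) ^+ n.+1).
Proof.
have h : altw true false (p * q) by apply: (altwM (j := true)); exact: altw1.
elim: n => [|n ih]; first by rewrite expr1.
by rewrite exprSr; apply: (altwM (j := false)).
Qed.
Let alt_qp n : altw false true ((q * p) ^+ n.+1).
Proof.
have h : altw false true (q * p) by apply: (altwM (j := false)); exact: altw1.
elim: n => [|n ih]; first by rewrite expr1.
by rewrite exprSr; apply: (altwM (j := true)).
Qed.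
Let alt_q_pq n : altw false false (q * (p * q) ^+ n).
Proof.
case: n => [|n]; first by rewrite expr0 mulr1; exact: altw1.
by apply: (altwM (j := false)); [exact: altw1|exact: alt_pq].
Qed.
Let alt_pq_p n : altw true true ((p * q) ^+ n * p).
Proof.
case: n => [|n]; first by rewrite expr0 mul1r; exact: altw1.
by apply: (altwM (j := false)); [exact: alt_pq|exact: altw1].
Qed.
Let alt_p_qp n : altw true true (p * (q * p) ^+ n).
Proof.
case: n => [|n]; first by rewrite expr0 mulr1; exact: altw1.
by apply: (altwM (j := true)); [exact: altw1|exact: alt_qp].
Qed.
Let alt0 := fun i j S => @altw_tau0 R W a b fab i j S.

Let sqr_letter i T : letter a b i T -> letter a b i (T * T - tau (T * T) *: 1).
Proof.
move=> [cT _]; split; last by rewrite tauB tauZ tau1 mulr1 subrr.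
rewrite -scaleNr addrC; apply: cstar_lin; last exact: cstar_mul.
by apply: starg_cstar; exact: sg_one.
Qed.

(** The central square q q is split into its centered part, which sits in an alternating word of
    trace 0, and the scalar tau (q q). The squares p p that then meet are treated alike. *)
Let tau_pqqp n : tau ((p * q) ^+ n * (q * p) ^+ n) = (tau (p * p) * tau (q * q)) ^+ n.
Proof.
elim: n => [|n ih]; first by rewrite !expr0 mulr1 tau1.
have step (L U T : vnop W) :
    tau (L * (T * T) * U) = tau (L * (T * T - tau (T * T) *: 1) * U) + tau (T * T) * tau (L * U).
  by rewrite mulrBr mulrBl tauB -scalerAr -scalerAl tauZ mulr1 subrK.
have -> : (p * q) ^+ n.+1 * (q * p) ^+ n.+1 = ((p * q) ^+ n * p) * (q * q) * (p * (q * p) ^+ n).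
  by rewrite exprSr exprS !mulrA.
rewrite step (alt0 (i := true) (j := true)) ?add0r; last first.
  by apply: (altwM (j := false)) => //; apply: (altwM (j := true)) => //; exact/altw1/sqr_letter.
have -> : ((p * q) ^+ n * p) * (p * (q * p) ^+ n) = (p * q) ^+ n * (p * p) * (q * p) ^+ n.
  by rewrite !mulrA.
rewrite step ih; suff -> : tau ((p * q) ^+ n * (p * p - tau (p * p) *: 1) * (q * p) ^+ n) = 0.
  by rewrite add0r exprS; ring.
have al := altw1 (sqr_letter lp).
(* For n = 0 nothing surrounds the centered square, which is a single letter. *)
case: n {ih} => [|n]; first by rewrite !expr0 mul1r mulr1; apply: alt0 al.
apply: (alt0 (i := true) (j := true)).
apply: (altwM (j := true)); last exact: alt_qp.
by apply: (altwM (j := false)) => //.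
Qed.

Let pE : A = p + ze%:C *: 1. Proof. by rewrite subrK. Qed.
Let qE : B = q + ze%:C *: 1. Proof. by rewrite subrK. Qed.

Let factor : A * (1 - w%:C *: (a * b)) * B = ze%:C *: (1 - X).
Proof.
(* u A a = A - 1, which turns the shift by ze into a shift by z. *)
have uA : u%:C *: (A * a) = p + z%:C *: 1.
  have : A - u%:C *: (A * a) = 1 by rewrite -A1 mulrBr mulr1 -scalerAr.
  move=> /(canRL (subrK _)) h; apply: (addrI 1); rewrite -h {1}pE addrCA; congr (_ + _).
  by rewrite /ze rmorphD scalerDl scale1r.
have vB : v%:C *: (b * B) = q + z%:C *: 1.
  have : B - v%:C *: (b * B) = 1 by rewrite -B2 mulrBl mul1r -scalerAl.
  move=> /(canRL (subrK _)) h; apply: (addrI 1); rewrite -h {1}qE addrCA; congr (_ + _).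
  by rewrite /ze rmorphD scalerDl scale1r.
have ab : w%:C *: (A * (a * b) * B) = (ze / z)%:C *: ((p + z%:C *: 1) * (q + z%:C *: 1)).
  have sc (c d : C) S T : (c *: S) * (d *: T) = (c * d) *: (S * T).
    by rewrite -scalerAl -scalerAr scalerA.
  rewrite -uA -vB sc scalerA !mulrA -!rmorphM.
  by congr (_%:C *: _).
rewrite mulrBr mulr1 mulrBl -scalerAr -scalerAl ab {1}pE {1}qE.
by apply: factor_alg => //; rewrite /ze addrK.
Qed.

Let FE : (1 - X) * F = 1.
Proof.
have h : ze%:C *: ((1 - X) * F) = ze%:C *: 1.
  rewrite scalerAl -factor /F -scalerAr; congr (_ *: _).
  by rewrite !mulrA -[_ * B * _]mulrA B1 mulr1 -[_ * _ * D]mulrA D1 mulr1.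
have zC : ze%:C != 0 :> C by rewrite eq_complex /= eqxx andbT.
by apply: (scalerI zC).
Qed.

Let Fsum n : F = \sum_(j < n) X ^+ j + X ^+ n * F.
Proof.
by apply: fixpoint_expand; have := FE; rewrite mulrBl mul1r => /(canRL (subrK _)).
Qed.

Let BFA : B * F * A = ze%:C *: D.
Proof.
rewrite /F -scalerAr -scalerAl; congr (_ *: _).
by rewrite !mulrA B1 mul1r -mulrA A2 mulr1.
Qed.

(** The order B, X^j, A matters: (p q)^j begins with p and ends with q, so after expanding B = q +
    ze and A = p + ze every word except the empty one at j = 0 alternates. *)
Let main_term j : tau (B * X ^+ j * A) = if j == 0%N then (ze ^+ 2)%:C else 0.
Proof.
have XE : X ^+ j = (k%:C ^+ j) *: (p * q) ^+ j by rewrite /X exprZn.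
set M := (p * q) ^+ j in XE.
rewrite XE -scalerAr -scalerAl tauZ pE qE shift_mul3 !tauD !tauZ.
have -> : tau (q * M * p) = 0.
  by apply: (alt0 (i := false) (j := true)); apply: (altwM (j := false)); [exact: alt_q_pq|exact: altw1].
rewrite (alt0 (alt_q_pq j)) (alt0 (alt_pq_p j)) !mulr0 !add0r.
case: j @M XE => [|j] M XE /=.
  by rewrite /M expr0 mul1r expr0 tau1 mulr1 rmorphXn.
by rewrite (alt0 (alt_pq j)) !mulr0.
Qed.

Lemma free_core : tau D = ze%:C.
Proof.
have zC : ze%:C != 0 :> C by rewrite eq_complex /= eqxx andbT.
have ze1 : ze < 1 by rewrite /ze gtrDl.
have [al eal /andP[al0 al1]] := variance_bound pa u0 ze1 A1 A2 aA tA.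
have [be ebe /andP[be0 be1]] := variance_bound pb v0 ze1 B1 B2 aB tB.
apply: (mulfI zC); rewrite -tauZ -BFA; apply/subr0_eq.
pose r := k ^+ 2 * (al * be).
have r01 : 0 <= r < 1.
  have g0 : 0 < ze - ze ^+ 2 by exact: le_lt_trans al1.
  have kg : k = - (ze - ze ^+ 2)^-1.
    rewrite /k -invrN; congr (_^-1); rewrite /ze; ring.
  rewrite /r kg sqrrN exprVn; apply/andP; split.
    by rewrite mulr_ge0 ?mulr_ge0// invr_ge0 exprn_ge0 ?ltW.
  by rewrite ltr_pdivrMl ?exprn_gt0// mulr1 expr2 ltr_pM.
(* Traciality moves B to the right end of the remainder, so the cofactor of the power of X does not
   depend on n. *)
pose G := F * A * B.
have [G' aG] := ex_adj G.
have g0 := tau_ge0 (adj_pos (adj_sym aG)).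
have [g eg] := complex_realP _ (ger0_real g0); rewrite eg ler0c in g0.
apply: (@norm_small _ _ 1) => // e e0.
have [n qn] := vanishing r01 g0 e0.
(* Taking n.+1 terms guarantees that the term j = 0, the only nonzero one, is present. *)
have rem : tau (B * F * A) - ze%:C * ze%:C = tau (X ^+ n.+1 * G).
  rewrite (Fsum n.+1) tau_sandwich; under eq_bigr do rewrite main_term.
  rewrite big_ord_recl /= big1 ?addr0; last by move=> j _.
  rewrite rmorphXn expr2 addrAC subrr add0r /G -!mulrA tau_mulC.
  by rewrite !mulrA.
rewrite rem mul1r; apply: (le_trans (tau_CS (S' := k%:C ^+ n.+1 *: (q * p) ^+ n.+1) _ aG)).
  have sp : adj p p by exact: adj_shift.
  have sq : adj q q by exact: adj_shift.
  have : adj X (k%:C *: (q * p)) by exact/adjZr/adjM.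
  by move/adj_exp => /(_ n.+1); rewrite [in X in adj _ X -> _]exprZn.
have -> : X ^+ n.+1 * (k%:C ^+ n.+1 *: (q * p) ^+ n.+1) =
    (k%:C ^+ n.+1 * k%:C ^+ n.+1) *: ((p * q) ^+ n.+1 * (q * p) ^+ n.+1).
  by rewrite /X exprZn -scalerAl -scalerAr scalerA.
rewrite tauZ tau_pqqp eal ebe eg -exprMn -exprMn.
have -> : (k%:C * k%:C * (al%:C * be%:C)) ^+ n.+1 * g%:C = (r ^+ n.+1 * g)%:C.
  by rewrite rmorphM rmorphXn /r !rmorphM.
rewrite lecR; apply: le_trans qn; rewrite exprS -mulrA ler_piMl//.
  by rewrite mulr_ge0// exprn_ge0//; case/andP: r01.
by rewrite ltW//; case/andP: r01.
Qed.
End Core.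
End FreeProduct.

(** * A positive operator has its distribution on the half-line *)

Section Distribution.
Local Open Scope complex_scope.
Variables (R : realType) (W : tracial_space R).
Local Notation H := (wp_space W).
Local Notation C := (R[i]).
Local Notation ip := (wp_dotp W).
Implicit Types (S T : vnop W).
Variables (rho : probability (measurableTypeR R) R) (T : vnop W) (L : R).
Hypotheses (sL : supp rho (- L) L) (pT : pos T)
  (mT : forall n, tau (T ^+ n) = (\int[rho]_x (x ^+ n))%:C).

(* The moments of (1 - th T)^(2n) are at most c^n with c = 1 + th d, whereas mass
   on the left of -d would contribute a multiple of c^(2n). *)
Lemma tail_null (d : R) : 0 < d -> rho `]-oo, - d]%classic = 0%E.
Proof.
move=> d0; have [cT [cT0 bT]] := ex_opb T.
have cT1 : 0 < cT + 1 by rewrite ltr_wpDl.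
(* As T >= 0, |1 - th T|^2 <= 1 + th^2 cT, and th cT <= d brings this below c = 1 + th d. For x <= -
   d the scalar 1 - th x is already at least c before squaring. *)
have [th th0 thc] : exists2 th : R, 0 < th & th * cT <= d.
  exists (d / (cT + 1)); first by rewrite divr_gt0.
  by rewrite mulrAC ler_pdivrMr// ler_pM2l// lerDl.
pose Y : vnop W := 1 - th%:C *: T.
pose c := 1 + th * d.
have c1 : 1 < c by rewrite /c ltrDl mulr_gt0.
have bY : opb Y c.
  split; first by rewrite ltW// (lt_trans ltr01).
  move=> x; have TxC : ip x (T x) = ip (T x) x by rewrite (pos_adj pT).
  have Tx0 : 0 <= ip (T x) x by exact: (posE T).1.
  rewrite /Y vnopDE vnopNE vnopZE vnop1E ipBl !ipBr !ipZl !ipZr TxC.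
  rewrite conj_Creal ?complex_real//.
  have h1 : 0 <= th%:C * ip (T x) x by rewrite mulr_ge0// ler0c ltW.
  have h2 : th%:C * (th%:C * ip (T x) (T x)) <= (th * d)%:C * ip x x.
    have h3 : th * (th * cT) <= th * d by rewrite ler_pM2l.
    have := ler_wpM2r (ip_ge0 x) (_ : (th * (th * cT))%:C <= (th * d)%:C).
    rewrite lecR => /(_ h3); apply: le_trans.
    rewrite !rmorphM -!mulrA !ler_wpM2l ?ler0c ?(ltW th0)//.
   have -> : c%:C = 1 + (th * d)%:C by rewrite /c rmorphD rmorph1.
  rewrite mulrDl mul1r -subr_ge0.
  rewrite -subr_ge0 in h2.
  by have := addr_ge0 (addr_ge0 h1 h1) h2; congr (_ <= _); ring.
pose E : set (measurableTypeR R) := `]-oo, - d]%classic.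
have mE : measurable E by exact: measurable_itv.
have tI : tame (- L) L (\1_E : R -> R).
  split; first exact: measurable_indic.
  by exists 1 => x _; rewrite indicE; case: (_ \in _); rewrite ?normr1 ?normr0.
pose m := \int[rho]_x (\1_E x : R).
have mP : (m%:E = rho E)%E.
  rewrite /m /Rintegral fineK integral_indic ?setIT//.
  by rewrite fin_num_measure.
have m0 : 0 <= m by rewrite -lee_fin mP measure_ge0.
suff m00 : m = 0 by rewrite -/E -mP m00.
have key n : m <= c^-1 ^+ n * 1.
  pose P : {poly R} := (1 - th *: 'X) ^+ (n * 2).
  have PE x : P.[x] = ((1 - th * x) ^+ n) ^+ 2.
    by rewrite /P horner_exp !hornerE exprM.
  have tP : tame (- L) L (fun x => P.[x]) by exact: tame_poly.
  have e1 : tau (pev T P) = (\int[rho]_x P.[x])%:C by exact: (tau_pev _ sL).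
  have pY : pev T P = Y ^+ (n * 2).
    rewrite pevE /P !rmorphXn /=; congr (_ ^+ _).
    rewrite rmorphB rmorphB /= !rmorph1 map_polyZ /= map_polyX horner_algZ.
    by rewrite horner_algX.
  have I0 : 0 <= \int[rho]_x P.[x].
    by apply: Rintegral_ge0 => x _; rewrite PE sqr_ge0.
  (* [opb Y c] bounds a squared norm, so Y^(2n) has norm at most c^n, against (c^n)^2 in [lb]. *)
  have ub : \int[rho]_x P.[x] <= c ^+ n.
    have := tau_bound (opbX (n * 2) bY); rewrite -pY e1.
    rewrite ger0_norm ?ler0c// -rmorphXn lecR exprM.
    by rewrite ler_pXn2r ?nnegrE ?exprn_ge0// ltW// (lt_trans ltr01).
  have lb : (c ^+ n) ^+ 2 * m <= \int[rho]_x P.[x].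
    rewrite -(intZ sL _ tI); apply: (int_le sL _ tP).
      by apply: tameM => //; exact: tame_cst.
    move=> x _; rewrite PE indicE; case: (boolP (x \in E)) => [|_]; last by rewrite mulr0 sqr_ge0.
    rewrite inE /E /= in_itv /= mulr1 => xd.
    have c0 : 0 <= c by rewrite ltW// (lt_trans ltr01).
    have cx : c <= 1 - th * x by rewrite /c lerD2l -mulrN ler_pM2l// lerNr.
    have x0 : 0 <= 1 - th * x by exact: le_trans cx.
    by do 2! (rewrite lerXn2r ?nnegrE ?exprn_ge0//).
  have cn : 0 < c ^+ n by rewrite exprn_gt0// (lt_trans ltr01).
  have := le_trans lb ub; rewrite expr2 -mulrA -ler_pdivlMl// mulVf ?gt_eqF// => h.
  by rewrite exprVn ler_pdivlMl.
have [//|mn0] := eqVneq m 0.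
have mp : 0 < m / 2 by rewrite divr_gt0// lt0r mn0.
have ci : 0 <= c^-1 < 1.
  by rewrite invr_ge0 invf_lt1 ?(lt_trans ltr01 c1)// c1 andbT ltW// (lt_trans ltr01).
have [n hn] := vanishing ci ler01 mp.
by have := le_trans (key n) hn; lra.
Qed.

Lemma pos_halfline : on_halfline rho.
Proof.
rewrite /on_halfline.
have -> : [set x : R | x < 0] = \bigcup_(n : nat) `]-oo, - (n.+1%:R^-1)]%classic.
  apply/seteqP; split=> x /=.
    move=> x0; have x0' : 0 < - x by rewrite oppr_gt0.
    have [n _ hn] := near_infty_natSinv_lt (PosNum x0').
    exists n => //=; rewrite in_itv /= lerNr ltW//; exact: (hn n (leqnn n)).
  by move=> [n _]; rewrite /= in_itv /= => /le_lt_trans; apply; rewrite oppr_lt0 invr_gt0.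
apply: measure_negligible.
  by apply: bigcupT_measurable => n; exact: measurable_itv.
apply: negligible_bigcup => n; apply/negligibleP; first exact: measurable_itv.
by apply: tail_null; rewrite invr_gt0.
Qed.
End Distribution.

(** * The relation between the psi functions of the three measures *)

Section FreePsi.
Local Open Scope complex_scope.
Variables (R : realType).
Local Notation C := (R[i]).

Lemma iter_vnop (W : tracial_space R) (T : vnop W) n : (T ^+ n : vnop W) = iter n T :> (_ -> _).
Proof.
elim: n => [|n ih]; first by apply/funext => x; rewrite expr0.
by apply/funext => x; rewrite exprS vnopME ih.
Qed.

Lemma free_psi (mu nu rho : probability (measurableTypeR R) R) :
  compactly_supported mu -> on_halfline mu ->
  compactly_supported nu -> on_halfline nu -> is_free_mul_conv mu nu rho ->
  [/\ compactly_supported rho, on_halfline rho & forall u v z, -1 < z -> z < 0 ->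
    u < 0 -> v < 0 -> psi mu u = z -> psi nu v = z ->
    psi rho ((1 + z) / z * u * v) = z].
Proof.
move=> cmu hmu cnu hnu [W [a' [b' [c' [[Ma Mb Mc] [pa pb pc cc] fab [[_ ma] [_ mb]] [crho mc]]]]]].
pose a := VNop Ma; pose b := VNop Mb; pose c := VNop Mc.
have cca : c * c = a by apply: vnop_eq => x; rewrite vnopME -[RHS]/(a' x) -cc.
pose T := c * b * c.
have ac : adj c c by exact: pos_adj.
have pT : pos T by exact: pos_conj.
have mT n : tau (T ^+ n) = (\int[rho]_x (x ^+ n))%:C.
  by rewrite -mc /tau iter_vnop.
have mA n : tau (a ^+ n) = (\int[mu]_x (x ^+ n))%:C by rewrite -ma /tau iter_vnop.
have mB n : tau (b ^+ n) = (\int[nu]_x (x ^+ n))%:C by rewrite -mb /tau iter_vnop.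
have [Lr Lr0 sr] := compact_supp 0 crho.
have hrho : on_halfline rho := pos_halfline sr pT mT.
split=> // u v z z1 z0 u0 v0 muz nuz.
have [La La0 sa] := compact_supp 0 cmu.
have [Lb Lb0 sb] := compact_supp 0 cnu.
have [A [A1 A2 aA cA tA]] := resolvent_tau (halfline_supp sa hmu) (pa : pos a) mA La0 (ltW u0).
have [B [B1 B2 aB cB tB]] := resolvent_tau (halfline_supp sb hnu) (pb : pos b) mB Lb0 (ltW v0).
rewrite muz in tA; rewrite nuz in tB.
set w := (1 + z) / z * u * v.
have w0 : w <= 0.
  have zz : (1 + z) / z <= 0 by rewrite mulr_ge0_le0 ?invr_le0 ?(ltW z0)// -lerBlDl sub0r ltW.
  by rewrite /w -mulrA mulr_le0_ge0// mulr_le0 ?ltW.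
have [E [E1 E2 _ _ tE]] := resolvent_tau (halfline_supp sr hrho) pT mT Lr0 w0.
(* (1 - x y)^-1 = 1 + x (1 - y x)^-1 y for x = w c and y = c b *)
pose D := 1 + w%:C *: (c * E * (c * b)).
have D1 : (1 - w%:C *: (a * b)) * D = 1.
  have ET : E = 1 + w%:C *: (T * E).
    by apply/(canRL (subrK _)); rewrite -E2 mulrBl mul1r -scalerAl.
  have abc : a * b = c * (c * b) by rewrite mulrA cca.
  have UV : c * E * (c * b) = c * (c * b) + w%:C *: (c * (T * E) * (c * b)).
    by rewrite {1}ET mulrDr mulrDl mulr1 -scalerAr -scalerAl.
  rewrite mulrBl mul1r /D mulrDr mulr1 -scalerAl -scalerAr abc.
  have -> : c * (c * b) * (c * E * (c * b)) = c * (T * E) * (c * b) by rewrite /T !mulrA.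
  by rewrite UV scalerDr addrK.
have := free_core (a := a) (b := b) fab pa pb u0 v0 z1 z0 A1 A2 B1 B2 aA aB cA cB tA tB D1.
have tET : w%:C * tau (E * T) = tau E - 1.
  have : E - w%:C *: (E * T) = 1 by rewrite -E1 mulrBr mulr1 -scalerAr.
  by move=> h; rewrite -(tau1 W) -h tauB tauZ opprB addrC subrK.
(* By traciality the correction term of D has trace w tau (E T) = tau E - 1. *)
have -> : tau D = tau E.
  rewrite /D tauD tauZ tau1.
  have -> : tau (c * E * (c * b)) = tau (E * T) by rewrite -mulrA tau_mulC /T !mulrA.
  by rewrite tET addrC subrK.
by rewrite tE => /complexI /addrI.
Qed.
End FreePsi.

Local Open Scope ring_scope.

Theorem corollary25 (R : realType)
  (mu nu rho : probability (measurableTypeR R) R)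
  (mu_compact : compactly_supported mu) (mu_ge0 : on_halfline mu)
  (mu_neq0 : ~ is_dirac0 mu)
  (nu_compact : compactly_supported nu) (nu_ge0 : on_halfline nu)
  (nu_neq0 : ~ is_dirac0 nu)
  (rhoE : is_free_mul_conv mu nu rho) (s : R) (hs : -1 <= s <= 0) :
  (S_transform mu s * S_transform nu s)%E = S_transform rho s.
Proof.
have [rho_compact rho_ge0 rel] := free_psi mu_compact mu_ge0 nu_compact nu_ge0 rhoE.
have [L L0 sL] := compact_supp 0 mu_compact.
have [K K0 sK] := compact_supp 0 nu_compact.
have [M M0 sM] := compact_supp 0 rho_compact.
exact: (S_transform_mul L0 (halfline_supp sL mu_ge0) (not_dirac0_atom mu_neq0)
  K0 (halfline_supp sK nu_ge0) (not_dirac0_atom nu_neq0)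
  M0 (halfline_supp sM rho_ge0) rel erefl hs).
Qed.
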